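(* Let $n \geq 5$ and let $G$ be the graph on the vertex set $[n]=\{1,\ldots,n\}$ whose complement $\overline{G}$ is a cycle of length $n$. Let $\widehat{G}$ be the suspension of $G$. Then $\widehat{G}$ is $( * )$-minimal, i.e., $\widehat{G}$ satisfies the following: (i) the toric ideal $I_{\widehat{G}}$ is generated by quadratic binomials; (ii) $I_{\widehat{G}}$ has no quadratic Gr\''obner basis; (iii) for any induced subgraph $H$ $(\neq \widehat{G})$ of $\widehat{G}$, the toric ideal $I_H$ of $H$ possesses a quadratic Gr\''obner basis.
   Context: All graphs are finite and simple (no loops, no multiple edges). $K$ is a field. For a graph $G$ on vertex set $[n]=\{1,\ldots,n\}$ with edge set $E(G)=\{e_1,\ldots,e_d\}$, put $t^{e}=t_it_j\in K[t_1,\ldots,t_n]$ for an edge $e=\{i,j\}$. The edge ring is $K[G]=K[t^{e_1},\ldots,t^{e_d}]\subset K[t_1,\ldots,t_n]$. Let $K[x_1,\ldots,x_d]$ be the polynomial ring with each $\deg x_i=1$; the toric ideal $I_G$ is the kernel of the surjective ring homomorphism $\pi:K[x_1,\ldots,x_d]\to K[G]$, $\pi(x_i)=t^{e_i}$. ''$I_G$ is generated by quadratic binomials'' means $I_G$ is generated by binomials $u-v$ with $u,v$ monomials of degree $2$; ''$I_G$ possesses a quadratic Gr\''obner basis'' means that, for some monomial order, $I_G$ has a Gr\''obner basis consisting of quadratic binomials. Convention: if $I_G=(0)$, then $I_G$ is said both to be generated by quadratic binomials and to possess a quadratic Gr\''obner basis. The complementary graph $\overline{G}$ of $G$ has the same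 vertex set as $G$, and its edges are the non-edges of $G$. The suspension $\widehat{G}$ of a graph $G$ on $[n]$ is the graph with vertex set $[n+1]=V(G)\cup\{n+1\}$ and edge set $E(G)\cup\{\{i,n+1\} \mid i\in V(G)\}$. An induced subgraph of a graph $G$ is a graph $G'$ with $V(G')\subset V(G)$ and $E(G')=\{\{i,j\}\in E(G)\mid i,j\in V(G')\}$. Condition $( * )$ for a graph $G$: $I_G$ is generated by quadratic binomials and $I_G$ possesses no quadratic Gr\''obner basis. A finite connected simple graph $G$ is $( * )$-minimal if $G$ satisfies $( * )$ and no induced subgraph $H$ $(\neq G)$ satisfies $( * )$. *)

(* Defs.v *)
From HB Require Import structures.
From mathcomp Require Import all_boot all_order all_algebra.
From mathcomp.multinomials Require Export mpoly.

Set Implicit Arguments.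
Unset Strict Implicit.
Unset Printing Implicit Defensive.

Import GRing.Theory.
Local Open Scope ring_scope.

(** * Finite simple graphs *)

Record sgraph (T : finType) := SGraph {
  adj : rel T;
  adj_sym : ssrbool.symmetric adj;
  adj_irrefl : irreflexive adj }.

Section Graphs.
Variable T : finType.
Implicit Type G : sgraph T.

Definition edges G : {set {set T}} :=
  [set [set p.1; p.2] | p : T * T & adj G p.1 p.2].

Definition connected_graph G : Prop := forall x y : T, connect (adj G) x y.

Definition compl_adj G : rel T := fun x y => (x != y) && ~~ adj G x y.

Lemma compl_adj_sym G : ssrbool.symmetric (compl_adj G).
Proof. by move=> x y; rewrite /compl_adj eq_sym adj_sym. Qed.

Lemma compl_adj_irrefl G : irreflexive (compl_adj G).
Proof. by move=> x; rewrite /compl_adj eqxx. Qed.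

Definition complement G : sgraph T :=
  SGraph (compl_adj_sym G) (compl_adj_irrefl G).

(* The added apex is [None], so that for [T = 'I_n] the vertex type
   [option 'I_n] has n + 1 elements. *)
Definition susp_adj G : rel (option T) := fun x y =>
  match x, y with
  | Some x', Some y' => adj G x' y'
  | None, None => false
  | _, _ => true
  end.

Lemma susp_adj_sym G : ssrbool.symmetric (susp_adj G).
Proof. by move=> [x|] [y|] //=; rewrite adj_sym. Qed.

Lemma susp_adj_irrefl G : irreflexive (susp_adj G).
Proof. by move=> [x|] //=; rewrite adj_irrefl. Qed.

Definition suspension G : sgraph (option T) :=
  SGraph (susp_adj_sym G) (susp_adj_irrefl G).

Definition ind_adj G (W : {set T}) : rel {x : T | x \in W} :=
  fun x y => adj G (val x) (val y).

Lemma ind_adj_sym G W : ssrbool.symmetric (@ind_adj G W).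
Proof. by move=> x y; rewrite /ind_adj adj_sym. Qed.

Lemma ind_adj_irrefl G W : irreflexive (@ind_adj G W).
Proof. by move=> x; rewrite /ind_adj adj_irrefl. Qed.

Definition induced G (W : {set T}) : sgraph {x : T | x \in W} :=
  SGraph (@ind_adj_sym G W) (@ind_adj_irrefl G W).

(* The whole graph is a cycle of length k: its vertices can be listed without
   repetition as c_0, ..., c_(k-1) so that the edges are exactly the pairs of
   cyclically consecutive vertices. *)
Definition is_cycle_graph (k : nat) G : Prop :=
  (2 < k)%N /\
  exists c : k.-tuple T,
    [/\ uniq c, forall x, x \in c
      & forall x y, adj G x y = (y == next c x) || (x == next c y)].

End Graphs.

(** * Ideals and Groebner bases *)

Definition ideal_gen (R : comNzRingType) (S : R -> Prop) (f : R) : Prop :=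
  exists s : seq (R * R),
    (forall p, p \in s -> S p.2) /\ f = \sum_(p <- s) p.1 * p.2.

Record monomial_order (d : nat) (ord : rel 'X_{1..d}) : Prop := MonomialOrder {
  mo_refl : reflexive ord;
  mo_anti : antisymmetric ord;
  mo_trans : transitive ord;
  mo_total : total ord;
  mo_min : forall m, ord 0%MM m;
  mo_add : forall m1 m2 m, ord m1 m2 -> ord (m1 + m)%MM (m2 + m)%MM }.

Section Groebner.
Variables (K : fieldType) (d : nat).
Local Notation P := {mpoly K[d]}.
Implicit Types (I : P -> Prop) (B : seq P).

(* No [m] satisfies this when [f = 0]. *)
Definition is_initial_monomial (ord : rel 'X_{1..d}) (f : P) (m : 'X_{1..d}) :=
  m \in msupp f /\ forall m', m' \in msupp f -> ord m' m.

Definition initial_ideal (ord : rel 'X_{1..d}) (S : P -> Prop) : P -> Prop :=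
  ideal_gen (fun u : P =>
    exists f m, [/\ S f, is_initial_monomial ord f m & u = 'X_[m]]).

Definition is_groebner_basis (ord : rel 'X_{1..d}) I B : Prop :=
  (forall b, b \in B -> I b /\ b != 0) /\
  forall f, initial_ideal ord I f <-> initial_ideal ord (fun b => b \in B) f.

Definition quadratic_binomial (b : P) : Prop :=
  exists u v : 'X_{1..d},
    [/\ mdeg u = 2%N, mdeg v = 2%N, u != v & b = 'X_[u] - 'X_[v]].

(* In both definitions the generating set may be empty, so the zero ideal
   satisfies them, in accordance with the usual convention. *)
Definition gen_by_quadratic_binomials I : Prop :=
  exists S : P -> Prop,
    (forall b, S b -> quadratic_binomial b) /\
    (forall f, I f <-> ideal_gen S f).

Definition has_quadratic_groebner_basis I : Prop :=
  exists ord : rel 'X_{1..d}, monomial_order ord /\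
  exists B : seq P,
    (forall b, b \in B -> quadratic_binomial b) /\ is_groebner_basis ord I B.

End Groebner.

(** * Toric ideals of edge rings *)

Section EdgeRing.
Variables (K : fieldType) (T : finType).
Implicit Type G : sgraph T.

(* The variable t_x of a vertex x is the one of index [enum_rank x]. *)
Definition edge_monomial (e : {set T}) : {mpoly K[#|T|]} :=
  \prod_(x in e) 'X_(enum_rank x).

(* The map pi, with codomain K[t_x : x in T] rather than its subring K[G],
   which is the image; the kernel is the same. *)
Definition edge_ring_map G (f : {mpoly K[#|edges G|]}) : {mpoly K[#|T|]} :=
  comp_mpoly [tuple edge_monomial (enum_val i) | i < #|edges G|] f.

Definition toric_ideal G (f : {mpoly K[#|edges G|]}) : Prop :=
  edge_ring_map f = 0.

Definition star_condition G : Prop :=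
  gen_by_quadratic_binomials (@toric_ideal G) /\
  ~ has_quadratic_groebner_basis (@toric_ideal G).

End EdgeRing.

Arguments toric_ideal K {T} G f.
Arguments star_condition K {T} G.

Definition star_minimal (K : fieldType) (T : finType) (G : sgraph T) : Prop :=
  [/\ connected_graph G, star_condition K G
    & forall W : {set T}, W != [set: T] -> ~ star_condition K (induced G W)].

Arguments star_minimal K {T} G.

(* Main.v *)
Require Import Defs.
From mathcomp Require Import all_boot all_order all_algebra zify.

Set Implicit Arguments.
Unset Strict Implicit.
Unset Printing Implicit Defensive.
Import GRing.Theory.

(** Two monomials in the edge variables have the same image in the edge ring
    exactly when, read as multisets of edges, they give every vertex the same
    degree; they then lie in the same fiber. The toric ideal contains the
    differences of monomials of one fiber, and the support of its elements never
    meets a fiber in a single monomial ([toric_fiber_ideal]). The vertices are put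
    on a circle, that is, given integer positions, and edges become chords.

    Proper induced subgraphs. Such a subgraph misses the apex or some vertex v
    of the cycle. In the second case the apex takes the place of v on the
    circle; in both cases two vertices that are not adjacent are neighbours on
    the circle, so whenever a < b < c < e the crossing chords ac and be are
    edges. Replacing two uncrossed disjoint chords by the crossing ones lowers a
    strictly convex weight ([chord_cost_cross]), and a multiset of pairwise
    crossing or touching chords is determined by its degrees
    ([crossing_family_unique]). Hence the uncrossing binomials form a quadratic
    Groebner basis ([crossings_groebner]); this is the sorting order of the
    second hypersimplex, restricted to a set of chords closed under sorting.

    Quadratic generation. The apex is at 0 and the cycle at 1, ..., n. Then
    {1, n} is the only non-edge between vertices that are not consecutive on the
    line, so uncrossing is blocked only at the pairs 01, jn and 0n, 1j. By
    induction on the degree it is enough that two monomials of one fiber can be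
    moved, by quadratic moves, to monomials with a common edge ([cone_meet]).
    Normal forms without a blocked pair share an edge by the previous argument,
    and a blocked pair in a normal form forces an edge 01 or 0n on the other
    monomial, after which a few explicit moves give a common edge.

    No quadratic Groebner basis. A monomial order compares the edges pq that
    avoid the apex through the monomials [key p q], the product of pq and of the
    apex edges at all other vertices. Delete the edges from the largest one down.
    The complement starts with a chordless n-cycle; the first deleted edge that is
    a chord of a chordless k-cycle of the complement cuts it into two shorter
    ones, one of which has length at least 4 if k is at least 5. So a chordless
    cycle of length 4 appears: two disjoint edges ab, ce, each of which is smaller
    than all edges between them. In the fiber of the monomial t_0^2 t_a t_b t_c t_e the
    monomials (ab)(0c)(0e) and (ce)(0a)(0b) then both have no smaller neighbour,
    so that the larger one is an initial monomial that no quadratic initial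
    monomial divides ([square_half]). *)

(** * Ideals and monomial ideals *)

Section IdealGen.
Local Open Scope ring_scope.
Variable R : comNzRingType.
Implicit Types (S : R -> Prop) (f g : R).

Lemma ideal_gen_in S f : S f -> ideal_gen S f.
Proof.
move=> Sf; exists [:: (1, f)]; split; last by rewrite big_seq1 mul1r.
by move=> p; rewrite inE => /eqP ->.
Qed.

Lemma ideal_gen0 S : ideal_gen S 0.
Proof. by exists [::]; rewrite big_nil. Qed.

Lemma ideal_genD S f g : ideal_gen S f -> ideal_gen S g -> ideal_gen S (f + g).
Proof.
move=> [s [Ss ->]] [t [St ->]]; exists (s ++ t); rewrite big_cat; split=> // p.
by rewrite mem_cat => /orP[/Ss|/St].
Qed.

Lemma ideal_genM S c f : ideal_gen S f -> ideal_gen S (c * f).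
Proof.
move=> [s [Ss ->]]; exists [seq (c * p.1, p.2) | p <- s]; split.
  by move=> _ /mapP[p /Ss Sp ->].
by rewrite big_map mulr_sumr; apply: eq_bigr => p _; rewrite mulrA.
Qed.

Lemma ideal_genN S f : ideal_gen S f -> ideal_gen S (- f).
Proof. by rewrite -mulN1r; apply: ideal_genM. Qed.

Lemma ideal_gen_sub (S S' : R -> Prop) f :
  (forall g, S g -> ideal_gen S' g) -> ideal_gen S f -> ideal_gen S' f.
Proof.
move=> SS' [s [Ss ->]]; elim: s Ss => [|p s IH] Ss.
  by rewrite big_nil; apply: ideal_gen0.
rewrite big_cons; apply: ideal_genD; last first.
  by apply: IH => q qs; apply: Ss; rewrite inE qs orbT.
by apply/ideal_genM/SS'/Ss; rewrite inE eqxx.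
Qed.

End IdealGen.

Section MonomialIdeal.
Local Open Scope ring_scope.
Variables (K : fieldType) (d : nat).

Lemma monomial_ideal_dvd (S : {mpoly K[d]} -> Prop) m :
    (forall g, S g -> exists u, g = 'X_[u]) -> ideal_gen S 'X_[m] ->
  exists u, S 'X_[u] /\ (u <= m)%MM.
Proof.
move=> Smon [s [Ss Em]].
have: 'X_[m]@_m != 0 :> K by rewrite mcoeffX eqxx oner_eq0.
rewrite Em raddf_sum /= -big_filter => s_m.
have [p ps pm] : exists2 p, p \in s & (p.1 * p.2)@_m != 0.
  apply/hasP; apply: contraR s_m => /hasPn s0.
  rewrite big_filter big_seq big1 // => p /s0.
  by rewrite negbK => /eqP.
have [u pu] := Smon _ (Ss _ ps); exists u; rewrite -pu; split; first exact: Ss.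
move: pm; rewrite pu -mcoeff_msupp (perm_mem (msuppMX _ _)) => /mapP[m' _ ->].
exact: lem_addr.
Qed.

Lemma msuppXB (u v : 'X_{1..d}) : u != v ->
  msupp ('X_[u] - 'X_[v] : {mpoly K[d]}) =i [:: u; v].
Proof.
move=> uv m; rewrite mcoeff_msupp mcoeffB !mcoeffX !inE ![m == _]eq_sym.
have [<-|_] := eqVneq u m; first by rewrite [v == u]eq_sym (negPf uv) subr0 oner_eq0.
by case: (v == m); rewrite ?subrr ?eqxx // sub0r oppr_eq0 oner_eq0.
Qed.

End MonomialIdeal.

(** * Chords of a circle *)

Lemma sum_pred_ord (S : pred nat) (y b : nat) :
  \sum_(p < b | S p) (y == p) = S y && (y < b).
Proof.
case: ltnP => yb; last first.
  rewrite andbF; apply: big1 => p _; apply/eqP; rewrite eqb0.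
  by have := ltn_ord p; lia.
rewrite andbT big_mkcond (bigD1 (Ordinal yb)) //= eqxx big1 ?addn0 ?if_same.
  by case: (S y).
move=> j jx; case: (S j) => //.
by apply/eqP; rewrite eqb0; apply: contra jx => /eqP xj; apply/eqP/val_inj.
Qed.

Lemma count2_eq (a b p q : nat) :
    (forall x, (a == x) + (b == x) = (p == x) + (q == x)) ->
  a = p /\ b = q \/ a = q /\ b = p.
Proof. by move=> H; have := H a; have := H b; lia. Qed.

(** A multigraph on at most four vertices, with two edges and given degrees, is
    one of the three pairings of its four edge ends. *)
Lemma count4_eq (a b c e p q r s : nat) :
    (forall x, (a == x) + (b == x) + (c == x) + (e == x) =
               (p == x) + (q == x) + (r == x) + (s == x)) ->
  let same a b p q := a = p /\ b = q \/ a = q /\ b = p in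
  [\/ same a b p q /\ same c e r s \/ same a b r s /\ same c e p q,
      same a b p r /\ same c e q s \/ same a b q s /\ same c e p r |
      same a b p s /\ same c e q r \/ same a b q r /\ same c e p s].
Proof.
move=> H.
have count3 p' q' r' : (forall x, (b == x) + (c == x) + (e == x) =
    (p' == x) + (q' == x) + (r' == x)) ->
  [\/ b = p' /\ (c = q' /\ e = r' \/ c = r' /\ e = q'),
      b = q' /\ (c = p' /\ e = r' \/ c = r' /\ e = p') |
      b = r' /\ (c = p' /\ e = q' \/ c = q' /\ e = p')].
  move=> H3; have : [|| b == p', b == q' | b == r'] by have := H3 b; lia.
  case/or3P=> /eqP bx; [apply: Or31 | apply: Or32 | apply: Or33]; split=> //;
    by apply: count2_eq => x; have := H3 x; rewrite bx; lia.
have : [|| a == p, a == q, a == r | a == s] by have := H a; lia.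
case/or4P=> /eqP ax /=.
- have /count3[] : forall x, (b == x) + (c == x) + (e == x) =
    (q == x) + (r == x) + (s == x) by move=> x; have := H x; rewrite ax; lia.
  + by case=> ? ?; apply: Or31; left; split; [left | ].
  + by case=> ? ?; apply: Or32; left; split; [left | ].
  by case=> ? ?; apply: Or33; left; split; [left | ].
- have /count3[] : forall x, (b == x) + (c == x) + (e == x) =
    (p == x) + (r == x) + (s == x) by move=> x; have := H x; rewrite ax; lia.
  + by case=> ? ?; apply: Or31; left; split; [right | ].
  + by case=> ? ?; apply: Or33; right; split; [left | ].
  by case=> ? ?; apply: Or32; right; split; [left | ].
- have /count3[] : forall x, (b == x) + (c == x) + (e == x) =
    (p == x) + (q == x) + (s == x) by move=> x; have := H x; rewrite ax; lia.
  + by case=> ? ?; apply: Or32; left; split; [right | ].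
  + by case=> ? ?; apply: Or33; right; split; [right | ].
  by case=> ? ?; apply: Or31; right; split; [left | ].
have /count3[] : forall x, (b == x) + (c == x) + (e == x) =
    (p == x) + (q == x) + (r == x) by move=> x; have := H x; rewrite ax; lia.
+ by case=> ? ?; apply: Or33; left; split; [right | ].
+ by case=> ? ?; apply: Or32; right; split; [right | ].
by case=> ? ?; apply: Or31; right; split; [right | ].
Qed.

(** Up to the constant N ^ 2 this is minus d (N - d) with d = q - p, a strictly
    convex function of d that is symmetric under d -> N - d, as the circle is. *)
Definition chord_cost N p q := (q - p) ^ 2 + N * (N - (q - p)).

(** If g1, g2, g3, g4 are the gaps from p to q, r, s and back to p around the
    circle, the right-hand sides exceed the left-hand sides by 2 g2 g4 and
    2 g1 g3. *)
Lemma chord_cost_cross N p q r s : p < q -> q < r -> r < s -> s < N ->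
  chord_cost N p r + chord_cost N q s < chord_cost N p q + chord_cost N r s /\
  chord_cost N p r + chord_cost N q s < chord_cost N p s + chord_cost N q r.
Proof.
move=> pq qr rs sN; rewrite /chord_cost.
have [a Da] : exists a, q = p + a.+1 by exists (q - p.+1); lia.
have [b Db] : exists b, r = p + a.+1 + b.+1 by exists (r - q.+1); lia.
have [c Dc] : exists c, s = p + a.+1 + b.+1 + c.+1 by exists (s - r.+1); lia.
have [e De] : exists e, N = a.+1 + b.+1 + c.+1 + e.+1 by exists (N - s + p - 1)%N; lia.
rewrite Da Db Dc in pq qr rs sN *.
have -> : p + a.+1 + b.+1 - p = a.+1 + b.+1 by lia.
have -> : p + a.+1 + b.+1 + c.+1 - (p + a.+1) = b.+1 + c.+1 by lia.
have -> : p + a.+1 - p = a.+1 by lia.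
have -> : p + a.+1 + b.+1 + c.+1 - (p + a.+1 + b.+1) = c.+1 by lia.
have -> : p + a.+1 + b.+1 + c.+1 - p = a.+1 + b.+1 + c.+1 by lia.
have -> : p + a.+1 + b.+1 - (p + a.+1) = b.+1 by lia.
have -> : N - (a.+1 + b.+1) = c.+1 + e.+1 by lia.
have -> : N - (b.+1 + c.+1) = a.+1 + e.+1 by lia.
have -> : N - a.+1 = b.+1 + c.+1 + e.+1 by lia.
have -> : N - c.+1 = a.+1 + b.+1 + e.+1 by lia.
have -> : N - (a.+1 + b.+1 + c.+1) = e.+1 by lia.
have -> : N - b.+1 = a.+1 + c.+1 + e.+1 by lia.
by rewrite De -!mulnn; split; lia.
Qed.

(** * Monomials as multisets of edges *)

Section Configuration.
(* Edge i joins the positions P i < Q i; a monomial is a multiset of edges. *)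
Variables (d : nat) (P Q : 'I_d -> nat).
Implicit Types (i j k l : 'I_d) (u v w : 'X_{1..d}) (p q r s : nat).

Definition vdeg u p := \sum_i u i * ((P i == p) + (Q i == p)).

Definition same_fiber u v := forall p, vdeg u p = vdeg v p.

Definition joins i p q :=
  ((P i == p) && (Q i == q)) || ((P i == q) && (Q i == p)).

Definition is_edge p q := [exists i, joins i p q].

Definition has_edge u p q := [exists i, (0 < u i) && joins i p q].

Lemma vdegD u v p : vdeg (u + v)%MM p = vdeg u p + vdeg v p.
Proof.
by rewrite -big_split; apply: eq_bigr => i _; rewrite /= mnmDE mulnDl.
Qed.

Lemma vdegU i p : vdeg U_(i)%MM p = (P i == p) + (Q i == p).
Proof.
rewrite /vdeg (bigD1 i) //= mnm1E eqxx mul1n big1 ?addn0 // => j ji.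
by rewrite mnm1E eq_sym (negPf ji).
Qed.

Lemma joins_sym i p q : joins i p q = joins i q p.
Proof. by rewrite /joins orbC. Qed.

Lemma is_edge_sym p q : is_edge p q = is_edge q p.
Proof. by apply: eq_existsb => i; rewrite joins_sym. Qed.

Lemma has_edge_sym u p q : has_edge u p q = has_edge u q p.
Proof. by apply: eq_existsb => i; rewrite joins_sym. Qed.

Lemma is_edgeP p q : reflect (exists i, joins i p q) (is_edge p q).
Proof. exact: existsP. Qed.

Lemma joins_vdeg i p q r : joins i p q -> vdeg U_(i)%MM r = (p == r) + (q == r).
Proof.
by rewrite vdegU => /orP[] /andP[/eqP -> /eqP ->] //; rewrite addnC.
Qed.

Lemma has_edge_is u p q : has_edge u p q -> is_edge p q.
Proof. by case/existsP=> i /andP[_ Hi]; apply/is_edgeP; exists i. Qed.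

Lemma has_edgeI u i : 0 < u i -> has_edge u (P i) (Q i).
Proof. by move=> ui; apply/existsP; exists i; rewrite ui /joins !eqxx. Qed.

Lemma joins_same i : joins i (P i) (Q i).
Proof. by rewrite /joins !eqxx. Qed.

Lemma vdeg_gt0 u p : 0 < vdeg u p -> exists q, has_edge u p q.
Proof.
rewrite lt0n sum_nat_eq0 negb_forall => /existsP[i].
rewrite /= muln_eq0 negb_or -lt0n => /andP[ui].
case: (eqVneq (P i) p) => [<- _|_].
  by exists (Q i); apply: has_edgeI.
case: (eqVneq (Q i) p) => [<- _|//].
by exists (P i); rewrite has_edge_sym; apply: has_edgeI.
Qed.

Lemma has_edge_vdeg u p q : has_edge u p q -> 0 < vdeg u p.
Proof.
case/existsP=> i /andP[ui Hi]; rewrite /vdeg (bigD1 i) //= addn_gt0.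
by rewrite muln_gt0 ui; case/orP: Hi => /andP[/eqP-> /eqP->]; rewrite !eqxx ?addn1.
Qed.

Lemma same_fiber_sym u v : same_fiber u v -> same_fiber v u.
Proof. by move=> uv p. Qed.

Lemma same_fiber_trans u v w :
  same_fiber u v -> same_fiber v w -> same_fiber u w.
Proof. by move=> uv vw p; rewrite uv. Qed.

Lemma same_fiberDl c u v :
  same_fiber (c + u)%MM (c + v)%MM <-> same_fiber u v.
Proof.
split=> uv p; last by rewrite !vdegD uv.
by have := uv p; rewrite !vdegD => /addnI.
Qed.

Variable N : nat.
Hypothesis PQ : forall i, P i < Q i.
Hypothesis QN : forall i, Q i < N.
Hypothesis PQ_inj : forall i j, P i = P j -> Q i = Q j -> i = j.

Lemma joins_inj i j p q : joins i p q -> joins j p q -> i = j.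
Proof.
move=> Hi Hj; have := PQ i; have := PQ j.
by case/orP: Hi => /andP[/eqP Pi /eqP Qi]; case/orP: Hj => /andP[/eqP Pj /eqP Qj];
   try lia; move=> _ _; apply: PQ_inj; rewrite ?Pi ?Qi ?Pj ?Qj.
Qed.

Lemma mdeg_vdeg u : (mdeg u).*2 = \sum_(p < N) vdeg u p.
Proof.
rewrite exchange_big mdegE -muln2 big_distrl /=; apply: eq_bigr => i _.
rewrite -big_distrr /=; congr (_ * _).
by rewrite big_split /= !(sum_pred_ord xpredT) QN (ltn_trans (PQ i)).
Qed.

Lemma same_fiber_mdeg u v : same_fiber u v -> mdeg u = mdeg v.
Proof.
move=> uv; apply: double_inj; rewrite !mdeg_vdeg.
by apply: eq_bigr => p _; rewrite uv.
Qed.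

Lemma mdeg0_eq u : mdeg u = 0 -> u = 0%MM.
Proof. by move/eqP; rewrite mdeg_eq0 => /eqP. Qed.

Lemma mnm_split1 u i : 0 < u i -> u = (U_(i) + (u - U_(i)))%MM.
Proof. by move=> ui; rewrite addmC submK // lep1mP -lt0n. Qed.

Lemma mdeg_gt0P u : 0 < mdeg u -> exists i, 0 < u i.
Proof.
rewrite mdegE lt0n sum_nat_eq0 negb_forall => /existsP[i ui].
by exists i; rewrite lt0n.
Qed.

(** The number of edge ends of u that lie in S. It depends on the fiber only,
    while its comparison with the number of edges says how the edges meet S. *)
Definition degin (S : pred nat) u := \sum_i u i * (S (P i) + S (Q i)).

Lemma degin_fiber S u v : same_fiber u v -> degin S u = degin S v.
Proof.
have E x : degin S x = \sum_(p < N | S p) vdeg x p.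
  rewrite exchange_big; apply: eq_bigr => i _; rewrite -big_distrr /=.
  by rewrite big_split /= !sum_pred_ord QN (ltn_trans (PQ i)) ?andbT.
by move=> uv; rewrite !E; apply: eq_bigr => p _; rewrite uv.
Qed.

(** If all edges of u meet S and one lies inside S, then u has more ends in S
    than it has edges; so has v, and some edge of v has both ends in S. *)
Lemma doubly_met_edge (S : pred nat) u v i : same_fiber u v ->
    (forall j, 0 < u j -> S (P j) || S (Q j)) ->
    0 < u i -> S (P i) && S (Q i) ->
  exists j, 0 < v j /\ S (P j) && S (Q j).
Proof.
move=> uv cover ui Si; have lt : mdeg u < degin S u.
  rewrite mdegE /degin (bigD1 i) //= [ltnRHS](bigD1 i) //= -addSn leq_add //.
    by case/andP: Si => -> ->; lia.
  apply: leq_sum => j _; have [->//|uj] := posnP (u j).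
  by rewrite -[leqLHS]muln1 leq_mul2l; apply/orP; right; have := cover _ uj; lia.
suff /exists_inP[j vj Sj] : [exists (j | 0 < v j), S (P j) && S (Q j)] by exists j.
apply: contraLR lt => /exists_inPn none.
rewrite -leqNgt (degin_fiber _ uv) (same_fiber_mdeg uv) mdegE.
apply: leq_sum => j _; have [->//|vj] := posnP (v j).
by rewrite -[leqRHS]muln1 leq_mul2l; apply/orP; right; have := none _ vj; lia.
Qed.

(** An asymmetric form of being uncrossed, in which i starts before j. Chords
    with a common end count as crossing. *)
Definition uncrossed i j := (Q i < P j) || ((P i < P j) && (Q j < Q i)).

(** Every edge has at most one end before Q i, since an edge with two would lie
    under the chord i or give P i a nearer neighbour; and every edge has
    an end in the closed arc of i, which itself counts twice. As the degree sums
    grow with the arc, this determines Q i from the fiber. *)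
Lemma nearest_neighbour_degin u i :
    (forall j, 0 < u j -> P i <= P j) ->
    (forall j, 0 < u j -> P j = P i -> Q i <= Q j) ->
    0 < u i -> (forall j, 0 < u j -> ~~ uncrossed i j) ->
  degin (gtn (Q i)) u <= mdeg u < degin (gtn (Q i).+1) u.
Proof.
move=> minP minQ ui cross; rewrite mdegE /degin /=; apply/andP; split.
  apply: leq_sum => j _; have [->//|uj] := posnP (u j).
  rewrite -[leqRHS]muln1 leq_mul2l; apply/orP; right.
  have := minP _ uj; have := minQ _ uj; have := cross _ uj; have := PQ j.
  rewrite /uncrossed; lia.
rewrite (bigD1 i) //= [ltnRHS](bigD1 i) //= -addSn leq_add //.
  by have := PQ i; rewrite !ltnS leqnn; nia.
apply: leq_sum => j _; have [->//|uj] := posnP (u j).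
rewrite -[leqLHS]muln1 leq_mul2l; apply/orP; right.
have := cross _ uj; have := PQ j; rewrite /uncrossed; lia.
Qed.

Definition crossing_family u :=
  forall i j, 0 < u i -> 0 < u j -> ~~ uncrossed i j.

Lemma lex_least_edge u : 0 < mdeg u -> exists i, [/\ 0 < u i,
    forall j, 0 < u j -> P i <= P j & forall j, 0 < u j -> P j = P i -> Q i <= Q j].
Proof.
move=> /mdeg_gt0P[i0 ui0].
case: (@arg_minnP _ i0 (fun i => 0 < u i) P) => // i1 ui1 minP.
have := @arg_minnP _ i1 (fun i => (0 < u i) && (P i == P i1)) Q.
case=> [|i /andP[ui /eqP Pi] minQ]; first by rewrite ui1 eqxx.
exists i; split=> // j uj; rewrite Pi; first exact: minP.
by move=> Pj; apply: minQ; rewrite uj Pj eqxx.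
Qed.

(** The first position of positive degree and its nearest neighbour are read off
    the degrees, so that u and v contain the same edge there. *)
Lemma crossing_common_edge u v : same_fiber u v -> 0 < mdeg u ->
  crossing_family u -> crossing_family v -> exists i, 0 < u i /\ 0 < v i.
Proof.
move=> uv u_gt0 Xu Xv.
have v_gt0 : 0 < mdeg v by rewrite -(same_fiber_mdeg uv).
have [i [ui minPi minQi]] := lex_least_edge u_gt0.
have [j [vj minPj minQj]] := lex_least_edge v_gt0.
have Pij : P i = P j.
  have [q vq] : exists q, has_edge v (P i) q.
    by apply: vdeg_gt0; rewrite -uv; apply: has_edge_vdeg (has_edgeI ui).
  have [q' uq'] : exists q, has_edge u (P j) q.
    by apply: vdeg_gt0; rewrite uv; apply: has_edge_vdeg (has_edgeI vj).
  case/existsP: vq => k /andP[vk Hk]; case/existsP: uq' => l /andP[ul Hl].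
  have := minPj _ vk; have := minPi _ ul; have := PQ k; have := PQ l.
  by case/orP: Hk; case/orP: Hl => /andP[/eqP ? /eqP ?] /andP[/eqP ? /eqP ?]; lia.
have Bi := nearest_neighbour_degin minPi minQi ui (fun j => Xu i j ui).
have Bj := nearest_neighbour_degin minPj minQj vj (fun i => Xv j i vj).
suff Qij : Q i = Q j by exists i; split=> //; rewrite (PQ_inj Pij Qij).
move: Bi Bj; rewrite !(degin_fiber _ uv) (same_fiber_mdeg uv).
have mono b c : b <= c -> degin (gtn b) v <= degin (gtn c) v.
  by move=> bc; apply: leq_sum => l _; rewrite leq_mul2l; apply/orP; right => /=; lia.
by have [/mono lt|/mono lt|//] := ltngtP (Q i) (Q j); lia.
Qed.

Lemma crossing_family_unique u v :
  same_fiber u v -> crossing_family u -> crossing_family v -> u = v.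
Proof.
have [k] := ubnP (mdeg u); elim: k u v => // k IH u v uk uv Xu Xv.
have [u0|u_gt0] := posnP (mdeg u).
  by rewrite (mdeg0_eq u0) (@mdeg0_eq v) // -(same_fiber_mdeg uv).
have [i [ui vi]] := crossing_common_edge uv u_gt0 Xu Xv.
have Ui x := @mnm_split1 x i.
have Xi x : crossing_family x -> crossing_family (x - U_(i))%MM.
  have sub l : 0 < (x - U_(i))%MM l -> 0 < x l by rewrite mnmBE; lia.
  by move=> Xx l l' /sub xl /sub xl'; apply: Xx.
rewrite (Ui u ui) (Ui v vi); congr (_ + _)%MM; apply: IH; [ | | exact: Xi | exact: Xi].
  by move: uk; rewrite {1}(Ui u ui) mdegD mdeg1.
by apply/(same_fiberDl U_(i)%MM); rewrite -!Ui.
Qed.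

(** * Uncrossing as a descent *)

Definition cost i := chord_cost N (P i) (Q i).
Definition wt u := \sum_i u i * cost i.

Lemma wtD u v : wt (u + v)%MM = wt u + wt v.
Proof. by rewrite -big_split; apply: eq_bigr => i _; rewrite /= mnmDE mulnDl. Qed.

Lemma wtU i : wt U_(i)%MM = cost i.
Proof.
rewrite /wt (bigD1 i) //= mnm1E eqxx mul1n big1 ?addn0 // => j ji.
by rewrite mnm1E eq_sym (negPf ji).
Qed.

(** No two uncrossed edges of u can be replaced by the crossing pair on the same
    four ends, because one of the crossing chords is not an edge. *)
Definition normal u := [forall i, forall j, (0 < u i) && (0 < u j) ==>
  ((Q i < P j) ==> ~~ (is_edge (P i) (P j) && is_edge (Q i) (Q j))) &&
  ((P i < P j) && (Q j < Q i) ==>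
     ~~ (is_edge (P i) (Q j) && is_edge (P j) (Q i)))].

Lemma normalP u : reflect (forall i j, 0 < u i -> 0 < u j ->
    (Q i < P j -> ~~ (is_edge (P i) (P j) && is_edge (Q i) (Q j))) /\
    (P i < P j -> Q j < Q i -> ~~ (is_edge (P i) (Q j) && is_edge (P j) (Q i))))
  (normal u).
Proof.
apply: (iffP idP) => [/forallP H i j ui uj|H].
  move/forallP/(_ j): (H i); rewrite ui uj /= => /andP[/implyP H1 /implyP H2].
  by split=> [/H1//|lt1 lt2]; apply: H2; rewrite lt1.
apply/forallP=> i; apply/forallP=> j; apply/implyP=> /andP[ui uj].
have [H1 H2] := H i j ui uj.
by apply/andP; split; apply/implyP => // /andP[]; apply: H2.
Qed.

Lemma split_two u i j : i != j -> 0 < u i -> 0 < u j ->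
  u = (U_(i) + U_(j) + (u - (U_(i) + U_(j))))%MM.
Proof.
move=> ij ui uj; rewrite addmC submK //; apply/mnm_lepP=> l.
rewrite mnmDE !mnm1E; case: (eqVneq i l) ij ui => [->|_] ij ui.
  by rewrite eq_sym (negPf ij) addn0.
by case: (eqVneq j l) uj => [->|].
Qed.

Lemma joins_cost k p q : p < q -> joins k p q ->
  cost k = chord_cost N p q.
Proof.
move=> pq Hk; have PQk := PQ k; rewrite /cost.
by case/orP: Hk => /andP[/eqP Pk /eqP Qk]; rewrite ?Pk ?Qk //; lia.
Qed.

(** The step of the normalisation: the two edges a of u are exchanged for the
    crossing pair b, which lowers the weight by [chord_cost_cross]. *)
Lemma uncross u : ~~ normal u -> exists a b c, [/\ u = (a + c)%MM,
  mdeg a = 2, mdeg b = 2, same_fiber a b & wt b < wt a].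
Proof.
suff E i j k l p q r s : [/\ 0 < u i, 0 < u j, joins i p q & joins j r s] ->
    joins k p r -> joins l q s -> i != j -> cost k + cost l < cost i + cost j ->
  exists a b c, [/\ u = (a + c)%MM,
    mdeg a = 2, mdeg b = 2, same_fiber a b & wt b < wt a].
  rewrite negb_forall => /existsP[i]; rewrite negb_forall => /existsP[j].
  rewrite negb_imply => /andP[/andP[ui uj]]; rewrite negb_and !negb_imply /= !andbT.
  have PQi := PQ i; have PQj := PQ j; have QNi := QN i; have QNj := QN j.
  case/orP=> [/andP[lt1] | /andP[/andP[lt1 lt2]]].
    move=> /andP[/is_edgeP[k Hk] /is_edgeP[l Hl]].
    have ij : i != j by apply: contraTneq lt1 => ->; lia.
    apply: (E i j k l (P i) (Q i) (P j) (Q j)) => //.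
      by split=> //; apply: joins_same.
    rewrite (joins_cost _ Hk) ?(joins_cost _ Hl) /cost; try lia.
    by have [] := @chord_cost_cross N (P i) (Q i) (P j) (Q j) PQi lt1 PQj QNj.
  move=> /andP[/is_edgeP[k Hk] /is_edgeP[l Hl]].
  have ij : i != j by apply: contraTneq lt1 => ->; lia.
  apply: (E i j k l (P i) (Q i) (Q j) (P j)) => //.
  - split=> //; first exact: joins_same.
    by rewrite joins_sym; apply: joins_same.
  - by rewrite joins_sym.
  rewrite (joins_cost _ Hk) ?(joins_cost _ Hl) /cost; try lia.
  by have [] := @chord_cost_cross N (P i) (P j) (Q j) (Q i) lt1 PQj lt2 QNi.
case=> ui uj Hi Hj; move=> Hk Hl ij lt.
exists (U_(i) + U_(j))%MM, (U_(k) + U_(l))%MM, (u - (U_(i) + U_(j)))%MM.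
split; rewrite ?mdegD ?mdeg1 ?wtD ?wtU //; first exact: split_two.
move=> x; rewrite !vdegD (joins_vdeg _ Hi) (joins_vdeg _ Hj).
by rewrite (joins_vdeg _ Hk) (joins_vdeg _ Hl); lia.
Qed.

(** * Ideals that are determined by fibers *)

Section Ideal.
Local Open Scope ring_scope.
Variable K : fieldType.
Notation poly := {mpoly K[d]}.

Definition fiber_move (b : poly) := exists u v,
  [/\ mdeg u = 2%N, mdeg v = 2%N, u != v, same_fiber u v & b = 'X_[u] - 'X_[v]].

(** The equivalence of u and v under quadratic moves, expressed by the ideal that
    the moves generate. *)
Definition linked u v := ideal_gen fiber_move ('X_[u] - 'X_[v]).

Lemma linked_refl u : linked u u.
Proof. by rewrite /linked subrr; apply: ideal_gen0. Qed.

Lemma linked_sym u v : linked u v -> linked v u.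
Proof. by move/ideal_genN; rewrite opprB. Qed.

Lemma linked_trans v u c : linked u v -> linked v c -> linked u c.
Proof.
by move=> uv vc; have := ideal_genD uv vc; rewrite /linked addrA subrK.
Qed.

Lemma linkedD c u v : linked u v -> linked (c + u)%MM (c + v)%MM.
Proof. by rewrite /linked !mpolyXD -mulrBr; apply: ideal_genM. Qed.

Lemma linked_quad u v : mdeg u = 2%N -> mdeg v = 2%N -> same_fiber u v -> linked u v.
Proof.
move=> u2 v2 uv; have [->|neq] := eqVneq u v; first exact: linked_refl.
by apply: ideal_gen_in; exists u, v.
Qed.

Lemma normal_form u : exists v,
  [/\ linked u v, same_fiber u v, normal v & v = u \/ (wt v < wt u)%N].
Proof.
have [k] := ubnP (wt u); elim: k u => // k IH u uk.
have [nu|/uncross[a [b [c [Du a2 b2 ab lt]]]]] := boolP (normal u).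
  by exists u; split=> //; [apply: linked_refl | left].
have lt' : (wt (b + c)%MM < wt u)%N by rewrite Du !wtD; lia.
have [|v [bv fv nv wv]] := IH (b + c)%MM; first exact: leq_trans lt' _.
exists v; split=> //.
- apply: linked_trans bv; rewrite Du ![(_ + c)%MM]addmC.
  by apply/linkedD/linked_quad.
- apply: same_fiber_trans fv; rewrite Du ![(_ + c)%MM]addmC.
  by apply/same_fiberDl.
by right; case: wv => [->//|/ltn_trans->].
Qed.

(** The properties of a toric ideal that the proof uses. The last one holds since
    the coefficients of an element of the ideal sum to 0 over every fiber. *)
Record fiber_ideal (I : poly -> Prop) : Prop := FiberIdeal {
  fiber_idealD : forall f g, I f -> I g -> I (f + g);
  fiber_idealM : forall c f : poly, I f -> I (c * f);
  fiber_ideal_binomial : forall u v, same_fiber u v -> I ('X_[u] - 'X_[v]);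
  fiber_ideal_supp : forall f m, I f -> m \in msupp f ->
    exists m', [/\ m' \in msupp f, m' != m & same_fiber m m'] }.

Lemma fiber_ideal_same_fiber I u v : fiber_ideal I -> u != v ->
  I ('X_[u] - 'X_[v]) -> same_fiber u v.
Proof.
move=> HI uv Iuv; have [|m [m_in m_u um]] := fiber_ideal_supp HI (m := u) Iuv.
  by rewrite msuppXB // !inE eqxx.
by move: m_in um; rewrite msuppXB // !inE (negPf m_u) => /eqP ->.
Qed.

(** Subtracting a multiple of a binomial inside the support of f cancels one term
    and creates none. *)
Lemma fiber_ideal_linked I f : fiber_ideal I ->
  (forall u v, same_fiber u v -> linked u v) -> I f -> ideal_gen fiber_move f.
Proof.
move=> HI link; have [k] := ubnP (size (msupp f)); elim: k f => // k IH f fk If.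
have [f0|[m mf]] : f = 0 \/ exists m, m \in msupp f.
- case E: (msupp f) => [|m s]; first by left; apply: msuppnil0.
  by right; exists m; rewrite inE eqxx.
- by rewrite f0; apply: ideal_gen0.
have [m' [m'f m'm mm']] := fiber_ideal_supp HI If mf.
set b : poly := 'X_[m] - 'X_[m'].
rewrite -[f](subrK (f@_m *: b)); apply: ideal_genD; last first.
  by rewrite -mul_mpolyC; apply/ideal_genM/link.
apply: IH; last first.
  apply: (fiber_idealD HI) => //; rewrite -scaleNr -mul_mpolyC.
  by apply/(fiber_idealM HI)/(fiber_ideal_binomial HI).
suff /(uniq_leq_size (msupp_uniq _)) : {subset msupp (f - f@_m *: b) <= rem m (msupp f)}.
  rewrite size_rem // => H; apply: leq_ltn_trans H _.
  by move: fk mf; case: (msupp f) => //= x s; rewrite ltnS.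
move=> x; rewrite (mem_rem_uniq _ (msupp_uniq _)) !inE.
rewrite mcoeff_msupp mcoeffB mcoeffZ mcoeffB !mcoeffX.
have [<-|mx] := eqVneq m x.
  by rewrite (negPf m'm) subr0 mulr1 subrr eqxx.
have [<-|m'x] := eqVneq m' x; first by rewrite m'f.
by rewrite subrr mulr0 subr0 mcoeff_msupp.
Qed.

(** * The sorting Groebner basis *)

Definition sort_order : rel 'X_{1..d} := fun u v =>
  (wt u < wt v)%N || ((wt u == wt v) && (u <= v)%O).

Lemma sort_order_monomial : monomial_order sort_order.
Proof.
rewrite /sort_order; split.
- by move=> u; rewrite eqxx Order.POrderTheory.lexx orbT.
- move=> u v /andP[]; case: ltngtP => //= _.
  by move=> uv vu; apply: Order.POrderTheory.le_anti; rewrite uv vu.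
- move=> v u c /orP[uv|/andP[/eqP-> uv]] /orP[vc|/andP[/eqP<- vc]].
  + by rewrite (ltn_trans uv vc).
  + by rewrite uv.
  + by rewrite vc.
  + by rewrite eqxx (Order.POrderTheory.le_trans uv vc) orbT.
- by move=> u v; case: ltngtP => //= _; apply: lemc_total.
- move=> u; rewrite le0m andbT orbC -leq_eqVlt.
  by rewrite {1}/wt big1 // => i _; rewrite mnm0E.
- by move=> u v c; rewrite !wtD ltn_add2r eqn_add2r lemc_add2l.
Qed.

Lemma sort_order_wt u v : sort_order u v -> (wt u <= wt v)%N.
Proof. by case/orP=> [/ltnW//|/andP[/eqP->]]. Qed.

Definition crossings_are_edges := forall i j,
  (Q i < P j -> is_edge (P i) (P j) && is_edge (Q i) (Q j))%N /\
  (P i < P j -> Q j < Q i -> is_edge (P i) (Q j) && is_edge (P j) (Q i))%N.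

Lemma normal_crossing_family u :
  crossings_are_edges -> normal u -> crossing_family u.
Proof.
move=> X /normalP nu i j ui uj; apply/negP.
have [n1 n2] := nu i j ui uj; have [X1 X2] := X i j.
by case/orP=> [lt|/andP[lt1 lt2]]; [move/negP: (n1 lt) | move/negP: (n2 lt1 lt2)];
  apply; [apply: X1 | apply: X2].
Qed.

Definition sorting_basis : seq poly :=
  let m2 (p : 'I_d * 'I_d) := (U_(p.1) + U_(p.2))%MM in
  [seq 'X_[m2 x.1] - 'X_[m2 x.2] | x <- enum {: ('I_d * 'I_d) * ('I_d * 'I_d)} &
     (wt (m2 x.2) < wt (m2 x.1))%N &&
     [forall r : 'I_N, vdeg (m2 x.1) r == vdeg (m2 x.2) r]].

Lemma vdeg_out u p : (N <= p)%N -> vdeg u p = 0%N.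
Proof.
move=> Np; apply: big1 => i _; have PQi := PQ i; have QNi := QN i.
have /negPf -> : P i != p by apply/eqP; lia.
by have /negPf -> : Q i != p; [apply/eqP; lia | rewrite muln0].
Qed.

Lemma same_fiberP u v :
  reflect (same_fiber u v) [forall r : 'I_N, vdeg u r == vdeg v r].
Proof.
apply: (iffP forallP) => [H p|uv p]; last by rewrite uv.
have [Np|pN] := leqP N p; first by rewrite !vdeg_out.
by have /eqP := H (Ordinal pN).
Qed.

Lemma mdeg2P u : mdeg u = 2%N -> exists i j, u = (U_(i) + U_(j))%MM.
Proof.
move=> u2; have [|i ui] := @mdeg_gt0P u; first by rewrite u2.
have Eu := mnm_split1 ui.
have /mdeg1P[j /eqP Ej] : mdeg (u - U_(i))%MM == 1%N.
  by move: u2; rewrite {1}Eu mdegD mdeg1 => /eqP.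
by exists i, j; rewrite {1}Eu Ej.
Qed.

Lemma sorting_basisP b : b \in sorting_basis <-> exists u v,
  [/\ mdeg u = 2%N, mdeg v = 2%N, same_fiber u v, (wt v < wt u)%N & b = 'X_[u] - 'X_[v]].
Proof.
split=> [/mapP[[[i j] [k l]]]|[u [v [/mdeg2P[i [j ->]] /mdeg2P[k [l ->]] uv lt ->]]]].
  rewrite mem_filter /= => /andP[/andP[lt /same_fiberP uv] _] ->.
  by exists (U_(i) + U_(j))%MM, (U_(k) + U_(l))%MM; rewrite !mdegD !mdeg1.
apply/mapP; exists ((i, j), (k, l)) => //.
by rewrite mem_filter /= lt mem_enum andbT; apply/same_fiberP.
Qed.

(** An initial monomial m that is not normal is divisible by an initial monomial
    of the basis. A normal m is impossible: another monomial m' of the same fiber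
    occurs in the polynomial, its normal form is m by uniqueness, and reducing m'
    to m strictly lowers the weight, whereas m is the largest monomial. *)
Theorem crossings_groebner I : fiber_ideal I -> crossings_are_edges ->
  has_quadratic_groebner_basis I.
Proof.
move=> HI X; exists sort_order; split; first exact: sort_order_monomial.
have neq u v : (wt v < wt u)%N -> u != v by apply: contraTneq => ->; rewrite ltnn.
have basisI b : b \in sorting_basis -> I b.
  by case/sorting_basisP=> u [v [_ _ uv _ ->]]; apply: (fiber_ideal_binomial HI).
exists sorting_basis; split.
  move=> b /sorting_basisP[u [v [u2 v2 _ lt ->]]].
  by exists u, v; rewrite u2 v2 neq.
split=> [b Bb|f].
  split; first exact: basisI.
  case/sorting_basisP: Bb => u [v [_ _ _ /neq uv ->]].
  by rewrite -msupp_eq0; apply/eqP => H; have := msuppXB K uv u; rewrite H !inE eqxx.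
split; last first.
  by apply: ideal_gen_sub => g [b [m [Bb ini ->]]]; apply: ideal_gen_in; exists b, m;
     split=> //; apply: basisI.
apply: ideal_gen_sub => _ [{}f [m [If [mf maxm] ->]]].
have [nm|/uncross[a [b [c [-> a2 b2 ab lt]]]]] := boolP (normal m); last first.
  rewrite addmC mpolyXD; apply/ideal_genM/ideal_gen_in.
  exists ('X_[a] - 'X_[b]), a; split=> //; first by apply/sorting_basisP; exists a, b.
  split=> [|m']; rewrite msuppXB ?neq // !inE ?eqxx //.
  by case/orP=> /eqP->; [apply: mo_refl sort_order_monomial _ | rewrite /sort_order lt].
have [m' [m'f m'm mm']] := fiber_ideal_supp HI If mf.
have [v [_ m'v nv wv]] := normal_form m'.
have Dv : m = v.
  by apply: crossing_family_unique; [apply: same_fiber_trans m'v | |];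
     try exact: normal_crossing_family.
have /sort_order_wt := maxm _ m'f; rewrite leqNgt Dv.
by case: wv => [vm'|->//]; rewrite Dv vm' eqxx in m'm.
Qed.

End Ideal.

(** * Quadratic generation for the suspended complement of a cycle *)

Section Reach.
Variable K : fieldType.

Definition reach u p q :=
  exists v, [/\ linked K u v, same_fiber u v & has_edge v p q].

Lemma reach_has u p q : has_edge u p q -> reach u p q.
Proof. by exists u; split=> //; apply: linked_refl. Qed.

Lemma has_edge_add i p q c : joins i p q -> has_edge (U_(i) + c)%MM p q.
Proof. by move=> Hi; apply/existsP; exists i; rewrite Hi mnmDE mnm1E eqxx. Qed.

(** The move pq, rs -> pr, qs. When the two edges coincide, pr is that edge. *)
Lemma swap u p q r s : has_edge u p q -> has_edge u r s ->
  is_edge p r -> is_edge q s -> reach u p r.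
Proof.
move=> upq; case/existsP: (upq) => i /andP[ui Hi] /existsP[j /andP[uj Hj]].
move=> /is_edgeP[k Hk] /is_edgeP[l Hl].
have [ij|ij] := eqVneq i j.
  apply: reach_has; suff -> : r = q by [].
  move: Hj; rewrite -ij /joins; have := PQ k; have := PQ l; have := PQ i.
  case/orP: Hi => /andP[/eqP -> /eqP ->]; case/orP: Hk => /andP[/eqP -> /eqP ->];
  case/orP: Hl => /andP[/eqP -> /eqP ->]; lia.
have fib : same_fiber (U_(i) + U_(j))%MM (U_(k) + U_(l))%MM.
  move=> x; rewrite !vdegD (joins_vdeg _ Hi) (joins_vdeg _ Hj).
  by rewrite (joins_vdeg _ Hk) (joins_vdeg _ Hl); lia.
set c := (u - (U_(i) + U_(j)))%MM.
exists (c + (U_(k) + U_(l)))%MM; split.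
- rewrite (split_two ij ui uj) [X in linked _ X _]addmC.
  by apply/linkedD/linked_quad; rewrite ?mdegD ?mdeg1.
- by rewrite (split_two ij ui uj) [X in same_fiber X _]addmC; apply/same_fiberDl.
by rewrite addmC -addmA; apply: has_edge_add.
Qed.

Definition meet u v := exists p q, reach u p q /\ reach v p q.

Lemma meet_sym u v : meet u v -> meet v u.
Proof. by case=> p [q [up vp]]; exists p, q. Qed.

Lemma meet_reach u v p q : reach u p q -> reach v p q -> meet u v.
Proof. by exists p, q. Qed.

(** Cancel the common edge and use induction on the degree. *)
Lemma linked_of_meet :
    (forall u v, same_fiber u v -> 0 < mdeg u -> meet u v) ->
  forall u v, same_fiber u v -> linked K u v.
Proof.
move=> all_meet u v; have [k] := ubnP (mdeg u); elim: k u v => // k IH u v uk uv.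
have [u0|u_gt0] := posnP (mdeg u).
  rewrite (mdeg0_eq u0) (@mdeg0_eq v) -?(same_fiber_mdeg uv) //.
  exact: linked_refl.
have [p [q [[u' [uu' fu /existsP[i /andP[ui Hi]]]]]]] := all_meet u v uv u_gt0.
case=> [v' [vv' fv /existsP[j /andP[vj Hj]]]].
move: vj; rewrite -(joins_inj Hi Hj) => vi.
have Ui x := @mnm_split1 x i.
apply: linked_trans uu' _; apply: linked_trans (linked_sym vv').
rewrite (Ui u') // (Ui v') //; apply/linkedD/IH.
  by move: uk; rewrite (same_fiber_mdeg fu) {1}(Ui u') // mdegD mdeg1.
apply/(same_fiberDl U_(i)%MM); rewrite -!Ui //.
by apply: same_fiber_trans fv; apply: same_fiber_trans uv; apply: same_fiber_sym.
Qed.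

Section ConedAnticycle.
Variable n : nat.
Hypothesis n_ge5 : 5 <= n.
(* The apex is 0 and the cycle of non-edges runs through 1, ..., n. *)
Hypothesis coneE : forall p q, p < q -> is_edge p q =
  (q <= n) && ((p == 0) || (p.+1 < q) && ~~ ((p == 1) && (q == n))).

Lemma QnP i : Q i <= n.
Proof.
have : is_edge (P i) (Q i) by apply/is_edgeP; exists i; apply: joins_same.
by rewrite coneE // => /andP[].
Qed.

Lemma cone_edgeP p q : is_edge p q <-> [/\ p <> q, p <= n, q <= n &
  p = 0 \/ q = 0 \/ p.+1 < q /\ ~ (p = 1 /\ q = n) \/
  q.+1 < p /\ ~ (q = 1 /\ p = n)].
Proof.
have [lt|lt|->] := ltngtP p q; last by split=> [/is_edgeP[i /orP]|[]//]; have := PQ i; lia.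
  by rewrite coneE //; split=> [|[]]; [split|]; lia.
by rewrite is_edge_sym coneE //; split=> [|[]]; [split|]; lia.
Qed.

(** An application of [doubly_met_edge] to S = {0, 1, n}: the edges inside S are
    01 and 0n, because 1n is not an edge. *)
Lemma cone_apex_edge u v i :
    same_fiber u v ->
    (forall j, 0 < u j -> [|| P j <= 1 | Q j == n]) ->
    0 < u i -> P i = 0 -> (Q i == 1) || (Q i == n) ->
  has_edge v 0 1 \/ has_edge v 0 n.
Proof.
move=> uv cover ui Pi Qi.
case: (@doubly_met_edge [pred p | (p <= 1) || (p == n)] u v i uv _ ui).
- by move=> j /cover /=; lia.
- by rewrite /= Pi; lia.
move=> j [vj /= Sj]; have Ej : is_edge (P j) (Q j).
  by apply/is_edgeP; exists j; apply: joins_same.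
have := PQ j; have := QnP j => Qn lt; move: (Ej); rewrite coneE // => Wj.
have Pj : P j = 0 by lia.
have := has_edgeI vj; rewrite Pj; have [-> | ->] : Q j = 1 \/ Q j = n by lia.
  by left.
by right.
Qed.

Lemma joins_ends i p q : p < q -> joins i p q -> P i = p /\ Q i = q.
Proof. by move=> pq /orP[] /andP[/eqP Pi /eqP Qi]; have := PQ i; lia. Qed.

(** Normality makes every edge of u that avoids 0 and 1 end at n, so that v
    contains 01 or 0n by [cone_apex_edge]. Only v with 0n and not 01 needs moves:
    if j >= 3 then u moves to 0n; if j = 2 then v moves to 2n or to 01,
    according to the neighbours of 2 and of 1 in v. *)
Lemma low_exception_meets u v (j : nat) : same_fiber u v -> normal u ->
  has_edge u 0 1 -> 1 < j -> has_edge u j n -> meet u v.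
Proof.
move=> uv nu u01 j1 ujn; case/existsP: (u01) => i /andP[ui /joins_ends[] // Pi Qi].
have /cone_edgeP[jn jn' _ Ejn] := has_edge_is ujn.
have E p q H : is_edge p q := (cone_edgeP p q).2 H.
case: (@cone_apex_edge u v i uv); rewrite ?Qi //.
- move=> l ul; have [H _] := (normalP _ nu) i l ui ul; rewrite Pi Qi in H.
  have PQl := PQ l; have Qln := QnP l; rewrite leqNgt.
  case: ltnP => //= lt; have := H lt; apply: contraNT => neq.
  by rewrite !E //; split; lia.
- by move=> v01; apply: meet_reach (reach_has u01) (reach_has v01).
move=> v0n; have [j3|j2] := ltnP 2 j.
  apply: (@meet_reach _ _ 0 n); last exact: reach_has.
  by apply: (swap (q := 1) (s := j)); rewrite 1?[has_edge _ n j]has_edge_sym //;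
     apply: E; split; lia.
have {j1 j2} Dj : j = 2 by lia. rewrite {j}Dj in ujn jn jn' Ejn.
have [m v2m] : exists m, has_edge v 2 m.
  by apply: vdeg_gt0; rewrite -uv; apply: has_edge_vdeg ujn.
have /cone_edgeP[m_2 _ m_n E2m] := has_edge_is v2m.
have [m0|m0] := eqVneq m 0; last first.
  apply: (@meet_reach _ _ n 2); first by apply: reach_has; rewrite has_edge_sym.
  apply: (swap (q := 0) (s := m)) => //; first by rewrite has_edge_sym.
    by apply: E; split; lia.
  by apply: E; split; lia.
rewrite {m}m0 in v2m m_2 m_n E2m.
have [m v1m] : exists m, has_edge v 1 m.
  apply: vdeg_gt0; rewrite -uv; apply: (@has_edge_vdeg _ 1 0).
  by rewrite has_edge_sym.
have /cone_edgeP[m_1 _ mn E1m] := has_edge_is v1m.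
apply: (@meet_reach _ _ 1 0); first by apply: reach_has; rewrite has_edge_sym.
have [m0|m0] := eqVneq m 0; first by apply: reach_has; rewrite m0 in v1m.
have [m4|m3] := ltnP 3 m.
  apply: (swap v1m (s := 2)); first by rewrite has_edge_sym.
    by apply: E; split; lia.
  by apply: E; split; lia.
apply: (swap v1m v0n); apply: E; split; lia.
Qed.

(** The mirror image of [low_exception_meets] under x -> n + 1 - x on the cycle:
    if j <= n - 2 then u moves to 01; if j = n - 1 then v moves to the edge
    joining 1 and n - 1, or to 0n. *)
Lemma high_exception_meets u v (j : nat) : same_fiber u v -> normal u ->
  has_edge u 0 n -> j < n -> has_edge u 1 j -> j != 0 -> meet u v.
Proof.
move=> uv nu u0n jn u1j j0.
case/existsP: (u0n) => i /andP[ui /joins_ends[]]; first by lia.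
move=> Pi Qi.
have /cone_edgeP[j_1 _ _ E1j] := has_edge_is u1j.
have E p q H : is_edge p q := (cone_edgeP p q).2 H.
case: (@cone_apex_edge u v i uv); rewrite ?Qi ?eqxx ?orbT //; last 1 first.
- by move=> v0n; apply: meet_reach (reach_has u0n) (reach_has v0n).
- move=> l ul; have [_ H] := (normalP _ nu) i l ui ul; rewrite Pi Qi in H.
  have PQl := PQ l; have Qln := QnP l; rewrite leqNgt.
  case: (ltnP 1 (P l)) => //= lt; apply/negP => neq.
  by have := H (ltnW lt); rewrite !E; [lia | split; lia | split; lia].
move=> v01; have [j2|j2] := ltnP j n.-1.
  apply: (@meet_reach _ _ 0 1); last exact: reach_has.
  by apply: (swap u0n u1j); apply: E; split; lia.
have {j2} Dj : j = n.-1 by lia. rewrite {j jn j0}Dj in u1j j_1 E1j.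
have [m vm] : exists m, has_edge v n.-1 m.
  by apply: vdeg_gt0; rewrite -uv; apply: (@has_edge_vdeg _ _ 1); rewrite has_edge_sym.
have /cone_edgeP[m_1 _ m_n Em] := has_edge_is vm.
have [m0|m0] := eqVneq m 0; last first.
  apply: (@meet_reach _ _ 1 n.-1); first exact: reach_has.
  apply: (swap (q := 0) (s := m)) => //; first by rewrite has_edge_sym.
    by apply: E; split; lia.
  by apply: E; split; lia.
rewrite {m}m0 in vm m_1 m_n Em.
have [m vnm] : exists m, has_edge v n m.
  by apply: vdeg_gt0; rewrite -uv; apply: (@has_edge_vdeg _ _ 0); rewrite has_edge_sym.
have /cone_edgeP[m_2 _ mn Enm] := has_edge_is vnm.
apply: (@meet_reach _ _ n 0); first by apply: reach_has; rewrite has_edge_sym.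
have [m0|m0] := eqVneq m 0; first by apply: reach_has; rewrite m0 in vnm.
have [m4|m3] := ltnP m (n - 2).
  apply: (swap vnm (s := n.-1)); first by rewrite has_edge_sym.
    by apply: E; split; lia.
  by apply: E; split; lia.
by apply: (swap vnm v01); apply: E; split; lia.
Qed.

(** The blocked crossing chord must be 1n, as it is the only non-edge between
    positions that are not consecutive. The chord that crosses it has an end
    below 1, which is the apex. *)
Lemma normal_exceptions u : normal u ->
  [\/ crossing_family u, has_edge u 0 1 /\ exists2 j : nat, 1 < j & has_edge u j n
    | has_edge u 0 n /\ exists2 j : nat, 0 < j < n & has_edge u 1 j].
Proof.
move=> /normalP nu.
have [/existsP[i /existsP[j]]|none] :=
  boolP [exists i, exists j, [&& 0 < u i, 0 < u j & uncrossed i j]]; last first.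
  apply: Or31 => i j ui uj; apply: contra none => ij.
  by apply/existsP; exists i; apply/existsP; exists j; rewrite ui uj.
case/and3P=> ui uj ij; have [n1 n2] := nu i j ui uj.
have E p q H : is_edge p q := (cone_edgeP p q).2 H.
have Hi := has_edgeI ui; have Hj := has_edgeI uj.
have PQi := PQ i; have PQj := PQ j; have Qi := QnP i; have Qj := QnP j.
case/orP: ij => [lt|/andP[lt1 lt2]].
  have := n1 lt; rewrite negb_and => /orP[|].
    by move/negP; case; apply: E; split; lia.
  have [/andP[/eqP Q1 /eqP Qjn] _|neq] := boolP ((Q i == 1) && (Q j == n)); last first.
    by move/negP; case; apply: E; split; lia.
  apply: Or32; have P0 : P i = 0 by lia.
  by rewrite P0 Q1 in Hi; split=> //; exists (P j); [lia | rewrite -Qjn].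
have := n2 lt1 lt2; rewrite negb_and => /orP[|].
  by move/negP; case; apply: E; split; lia.
have [/andP[/eqP P1 /eqP Qin] _|neq] := boolP ((P j == 1) && (Q i == n)); last first.
  by move/negP; case; apply: E; split; lia.
apply: Or33; have P0 : P i = 0 by lia.
by rewrite P0 Qin in Hi; split=> //; exists (Q j); [lia | rewrite -P1].
Qed.

Lemma cone_meet u v : same_fiber u v -> 0 < mdeg u -> meet u v.
Proof.
move=> uv u_gt0; have [u' [uu' fu nu' _]] := normal_form K u.
have [v' [vv' fv nv' _]] := normal_form K v.
have fu'v' : same_fiber u' v'.
  exact: same_fiber_trans (same_fiber_sym fu) (same_fiber_trans uv fv).
have u'_gt0 : 0 < mdeg u' by rewrite -(same_fiber_mdeg fu).
suff [p [q [[u2 [l2 f2 H2]] [v2 [l3 f3 H3]]]]] : meet u' v'.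
  exists p, q; split; [exists u2 | exists v2]; split=> //.
  - exact: linked_trans l2.
  - exact: same_fiber_trans f2.
  - exact: linked_trans l3.
  exact: same_fiber_trans f3.
have exc x y : same_fiber x y -> normal x -> crossing_family x \/ meet x y.
  move=> xy nx; have [Xx|[x01 [j j1 xjn]]|[x0n [j /andP[j0 jn] x1j]]] := normal_exceptions nx.
  - by left.
  - by right; apply: low_exception_meets xjn.
  by right; apply: high_exception_meets x1j _; rewrite -?lt0n.
have [Xu|//] := exc _ _ fu'v' nu'.
have [Xv|/meet_sym//] := exc _ _ (same_fiber_sym fu'v') nv'.
have [i [ui vi]] := crossing_common_edge fu'v' u'_gt0 Xu Xv.
by apply: meet_reach (reach_has (has_edgeI ui)) (reach_has (has_edgeI vi)).
Qed.

Local Open Scope ring_scope.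

Theorem cone_gen_quadratic (I : {mpoly K[d]} -> Prop) : fiber_ideal I ->
  gen_by_quadratic_binomials I.
Proof.
move=> HI; exists (@fiber_move K); split.
  by move=> _ [u [v [u2 v2 uv _ ->]]]; exists u, v.
move=> f; split.
  by apply: fiber_ideal_linked => // u v; apply: linked_of_meet; apply: cone_meet.
case=> s [Ss ->]; elim: s Ss => [|p s IH] Ss.
  by rewrite big_nil -(subrr 'X_[0]); apply: (fiber_ideal_binomial HI).
rewrite big_cons; apply: (fiber_idealD HI); last first.
  by apply: IH => q qs; apply: Ss; rewrite inE qs orbT.
apply: (fiber_idealM HI); have [|u [v [_ _ _ uv ->]]] := Ss p.
  by rewrite inE eqxx.
exact: (fiber_ideal_binomial HI).
Qed.

(** * Obstruction to quadratic Groebner bases *)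

Section NoGroebner.
Variables (I : {mpoly K[d]} -> Prop) (ord : rel 'X_{1..d}) (B : seq {mpoly K[d]}).
Hypothesis HI : fiber_ideal I.
Hypothesis Hord : monomial_order ord.
Hypothesis B_quad : forall b, b \in B -> quadratic_binomial b.
Hypothesis B_groebner : is_groebner_basis ord I B.

(** The larger of two monomials of a fiber is an initial monomial of the ideal,
    so a quadratic move to a smaller monomial applies to it. *)
Lemma groebner_reducible m1 m2 : same_fiber m1 m2 -> m1 != m2 -> ord m2 m1 ->
  exists u v, [/\ mdeg u = 2%N, mdeg v = 2%N & same_fiber u v] /\
    [/\ u != v, ord v u & (u <= m1)%MM].
Proof.
move=> m12 neq le21; have [BI inB] := B_groebner.
have ini (u v : 'X_{1..d}) : u != v -> ord v u ->
    is_initial_monomial ord ('X_[u] - 'X_[v] : {mpoly K[d]}) u.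
  move=> uv vu; split=> [|m]; rewrite msuppXB // !inE ?eqxx // => /orP[]/eqP-> //.
  exact: mo_refl Hord _.
have : initial_ideal ord I ('X_[m1]).
  apply: ideal_gen_in; exists ('X_[m1] - 'X_[m2]), m1; split=> //.
    exact: (fiber_ideal_binomial HI).
  exact: ini.
move=> /inB /monomial_ideal_dvd[|u [[b [m [bB [mb maxm]]]]]].
  by move=> g [b [m [_ _ ->]]]; exists m.
move=> Eum um1; have {Eum} Dm : u = m.
  have : u \in msupp ('X_[u] : {mpoly K[d]}) by rewrite msuppX inE.
  by rewrite Eum msuppX inE => /eqP.
rewrite {u}Dm in um1.
have [x [y [x2 y2 xy Db]]] := B_quad bB; have [Ib _] := BI b bB.
rewrite Db in mb maxm Ib; have fxy := fiber_ideal_same_fiber HI xy Ib.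
have Ox := maxm x; have Oy := maxm y.
rewrite !msuppXB // !inE !eqxx ?orbT in mb Ox Oy.
case/orP: mb => /eqP Dm; rewrite {m maxm}Dm in um1 Ox Oy *.
  by exists x, y; split=> //; split=> //; apply: Oy.
exists y, x; split; first by split=> //; apply: same_fiber_sym.
by rewrite eq_sym xy; split=> //; apply: Ox.
Qed.

Local Close Scope ring_scope.

(** The edge pq as a monomial, equal to 1 if pq is not an edge. *)
Definition emon p q : 'X_{1..d} := [multinom (joins i p q : nat) | i < d].

Lemma emon_sym p q : emon p q = emon q p.
Proof. by apply/mnmP=> i; rewrite !mnmE joins_sym. Qed.

Lemma emonE i p q : joins i p q -> emon p q = U_(i)%MM.
Proof.
move=> Hi; apply/mnmP=> j; rewrite mnmE mnm1E; congr nat_of_bool.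
by apply/idP/eqP=> [Hj|<-//]; apply: joins_inj Hi Hj.
Qed.

Lemma joins_eqE i p q r s : joins i p q ->
  joins i r s = (p == r) && (q == s) || (p == s) && (q == r).
Proof.
by rewrite {2}/joins; case/orP=> /andP[/eqP-> /eqP->] //; rewrite orbC [_ && (p == r)]andbC
  [(q == r) && _]andbC.
Qed.

Lemma quadratic_fiber i j v p q r s : joins i p q -> joins j r s ->
    mdeg v = 2 -> same_fiber (U_(i) + U_(j))%MM v ->
  [\/ v = (U_(i) + U_(j))%MM,
      [/\ is_edge p r, is_edge q s & v = (emon p r + emon q s)%MM] |
      [/\ is_edge p s, is_edge q r & v = (emon p s + emon q r)%MM]].
Proof.
move=> Hi Hj /mdeg2P[k [l ->]] fib.
have J x p' q' : P x = p' /\ Q x = q' \/ P x = q' /\ Q x = p' -> joins x p' q'.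
  by rewrite /joins; lia.
have [] := @count4_eq (P k) (Q k) (P l) (Q l) p q r s.
- move=> x; have := fib x; rewrite !vdegD (joins_vdeg _ Hi) (joins_vdeg _ Hj).
  by rewrite !vdegU; lia.
- case=> [[/J Hk /J Hl]|[/J Hk /J Hl]]; apply: Or31.
    by rewrite (joins_inj Hi Hk) (joins_inj Hj Hl).
  by rewrite (joins_inj Hi Hl) (joins_inj Hj Hk) addmC.
- case=> [[/J Hk /J Hl]|[/J Hk /J Hl]]; apply: Or32; rewrite (emonE Hk) (emonE Hl);
    by split; [apply/is_edgeP; eexists; eassumption.. | rewrite // addmC].
case=> [[/J Hk /J Hl]|[/J Hk /J Hl]]; apply: Or33; rewrite (emonE Hk) (emonE Hl);
  by split; [apply/is_edgeP; eexists; eassumption.. | rewrite // addmC].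
Qed.

Definition apex_mon (s : seq nat) : 'X_{1..d} :=
  (\sum_(t < n.+1 | (0 < t)%N && ((t : nat) \notin s)) emon 0 t)%MM.

(** The keys of all edges ab that avoid the apex lie in one fiber, so the monomial
    order compares any two edges, also when they are disjoint. *)
Definition key a b := (emon a b + apex_mon [:: a; b])%MM.

Lemma apex_mon_mem (s1 s2 : seq nat) : s1 =i s2 -> apex_mon s1 = apex_mon s2.
Proof. by move=> s12; apply: eq_bigl => t; rewrite s12. Qed.

Lemma apex_mon_cons y (S : seq nat) : 0 < y <= n -> y \notin S ->
  apex_mon S = (emon 0 y + apex_mon (y :: S))%MM.
Proof.
case/andP=> y0 yn ys; have yn' : y < n.+1 by [].
rewrite /apex_mon (bigD1 (Ordinal yn')) /= ?y0 //; congr (_ + _)%MM.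
by apply: eq_bigl => t; rewrite inE negb_or -val_eqE /= andbAC -!andbA.
Qed.

Lemma key_sym a b : key a b = key b a.
Proof.
rewrite /key emon_sym; congr (_ + _)%MM; apply: apex_mon_mem => t.
by rewrite !inE orbC.
Qed.

Lemma keyE a b y : 0 < y <= n -> y != a -> y != b ->
  key a b = (emon a b + emon 0 y + apex_mon [:: a; b; y])%MM.
Proof.
move=> yn ya yb; rewrite /key (@apex_mon_cons y) // ?inE ?negb_or ?ya //.
rewrite addmA; congr (_ + _)%MM; apply: apex_mon_mem => t.
by rewrite !inE; case: (t == y); rewrite ?orbT ?orbF.
Qed.

(** The factor ab of [key a b] is the only one that avoids the apex. *)
Lemma key_inj a b a' b' : 0 < a -> 0 < b -> is_edge a b ->
  key a b = key a' b' -> a = a' /\ b = b' \/ a = b' /\ b = a'.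
Proof.
move=> a0 b0 /is_edgeP[i Hi] /mnmP/(_ i).
have H0 t : joins i 0 t = false.
  by apply/negP; move: Hi; rewrite /joins; have := PQ i; lia.
have no_apex S : apex_mon S i = 0.
  by rewrite /apex_mon mnm_sumE big1 // => t _; rewrite mnmE H0.
rewrite !mnmDE !no_apex !addn0 !mnmE Hi; move: Hi; rewrite /joins; lia.
Qed.

(** A quadratic move from (ab)(0c)(0e) exchanges two of its three factors. Two
    apex edges allow no move, and ab with 0y leads to by with 0a or to ay
    with 0b; multiplying by the remaining apex edges compares keys, so by the
    hypothesis these moves increase the monomial. *)
Lemma square_half a b c e :
    uniq [:: 0; a; b; c; e] -> all (leq^~ n) [:: a; b; c; e] ->
    is_edge a b ->
    (forall x y, x \in [:: a; b] -> y \in [:: c; e] -> is_edge x y ->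
       ~~ ord (key x y) (key a b)) ->
  ord (emon c e + emon 0 a + emon 0 b)%MM (emon a b + emon 0 c + emon 0 e)%MM ->
  is_edge c e -> False.
Proof.
move=> U L Eab high le21 Ece.
have D s t : s < 5 -> t < 5 ->
    (nth 0 [:: 0; a; b; c; e] s == nth 0 [:: 0; a; b; c; e] t) = (s == t).
  by move=> s5 t5; apply: nth_uniq.
have ac : (a == c) = false := D 1 3 isT isT.
have ae : (a == e) = false := D 1 4 isT isT.
have bc : (b == c) = false := D 2 3 isT isT.
have be : (b == e) = false := D 2 4 isT isT.
have ab : (a == b) = false := D 1 2 isT isT.
have ce : (c == e) = false := D 3 4 isT isT.
have a0 : (a == 0) = false := D 1 0 isT isT.
have b0 : (b == 0) = false := D 2 0 isT isT.
have c0 : (c == 0) = false := D 3 0 isT isT.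
have e0 : (e == 0) = false := D 4 0 isT isT.
have apex_range y : y \in [:: a; b; c; e] -> 0 < y <= n.
  move=> yin; rewrite lt0n (allP L y yin) andbT.
  by move: yin; rewrite !inE => /or4P[]/eqP->; rewrite ?a0 ?b0 ?c0 ?e0.
have apexE y : y \in [:: a; b; c; e] -> is_edge 0 y.
  by move=> /apex_range/andP[y0 yn]; apply/cone_edgeP; clear -y0 yn; split; lia.
have in_ab x : x \in [:: a; b] -> x \in [:: a; b; c; e].
  by rewrite !inE => /orP[]->; rewrite ?orbT.
have in_ce x : x \in [:: c; e] -> x \in [:: a; b; c; e].
  by rewrite !inE => /orP[]->; rewrite ?orbT.
case/is_edgeP: (Eab) => iab Hab; case/is_edgeP: Ece => ice Hce.
have [ia Ha] : exists i, joins i 0 a by apply/is_edgeP/apexE; rewrite !inE eqxx ?orbT.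
have [ib Hb] : exists i, joins i 0 b by apply/is_edgeP/apexE; rewrite !inE eqxx ?orbT.
have [ic Hc] : exists i, joins i 0 c by apply/is_edgeP/apexE; rewrite !inE eqxx ?orbT.
have [ie He] : exists i, joins i 0 e by apply/is_edgeP/apexE; rewrite !inE eqxx ?orbT.
set m1 := (emon a b + _ + _)%MM in le21 *.
have [||u [v [[u2 v2 uv] [neq vu um]]]] := groebner_reducible _ _ le21.
- move=> x; rewrite !vdegD (emonE Hab) (emonE Hce) (emonE Ha) (emonE Hb) (emonE Hc) (emonE He).
  rewrite (joins_vdeg _ Hab) (joins_vdeg _ Hce) (joins_vdeg _ Ha) (joins_vdeg _ Hb).
  by rewrite (joins_vdeg _ Hc) (joins_vdeg _ He); clear; lia.
- apply/eqP=> /mnmP/(_ iab); rewrite !mnmE !(joins_eqE _ _ Hab).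
  by rewrite !eqxx ac ae a0 b0 ?andbF /=.
have m1E l : m1 l = joins l a b + joins l 0 c + joins l 0 e by rewrite !mnmE.
have two_ab i j y : joins i a b -> joins j 0 y -> y \in [:: c; e] ->
    u = (U_(i) + U_(j))%MM -> False.
  move=> Hi Hj yce Du; have y_ab : [/\ 0 < y <= n, y != a & y != b].
    split; first exact: apex_range (in_ce _ yce).
      by move: yce; rewrite !inE => /orP[]/eqP->; rewrite eq_sym ?ac ?ae.
    by move: yce; rewrite !inE => /orP[]/eqP->; rewrite eq_sym ?bc ?be.
  have [y0n ya yb] := y_ab; rewrite Du in uv neq vu.
  have lift x x' : is_edge x y -> x \in [:: a; b] -> x' \in [:: a; b] -> x != x' ->
      v = (emon x y + emon 0 x')%MM -> False.
    move=> Exy xin x'in xx' Dv; case/negP: (high x y xin yce Exy).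
    rewrite (@keyE x y x'); first rewrite (@keyE a b y) //.
    - have -> : apex_mon [:: x; y; x'] = apex_mon [:: a; b; y].
        apply: apex_mon_mem => t; move: xin x'in xx'; rewrite !inE.
        case/orP=> /eqP->; case/orP=> /eqP->; rewrite ?eqxx // => _;
        by case: (t == a); case: (t == b); case: (t == y).
      by apply: (mo_add Hord); rewrite -Dv (emonE Hi) (emonE Hj).
    - exact: apex_range (in_ab _ x'in).
    - by rewrite eq_sym.
    by rewrite eq_sym; move: x'in; rewrite !inE => /orP[]/eqP->.
  have [Dv|[Ea0 Eby Dv]|[Eay Eb0 Dv]] := quadratic_fiber Hi Hj v2 uv.
  - by rewrite Dv eqxx in neq.
  - apply: (lift b a Eby); rewrite ?inE ?eqxx ?orbT //; first by rewrite eq_sym ab.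
    by rewrite Dv addmC [emon a 0]emon_sym.
  apply: (lift a b Eay); rewrite ?inE ?eqxx ?orbT //; first by rewrite ab.
  by rewrite Dv [emon b 0]emon_sym.
have two_apex i j : joins i 0 c -> joins j 0 e -> u = (U_(i) + U_(j))%MM -> False.
  move=> Hi Hj Du; rewrite Du in uv neq.
  have [Dv|[E00 _ _]|[_ _ Dv]] := quadratic_fiber Hi Hj v2 uv.
  - by rewrite Dv eqxx in neq.
  - by have [] := (cone_edgeP _ _).1 E00.
  by case/eqP: neq; rewrite Dv (emonE Hj) emon_sym (emonE Hi) addmC.
have [i [j Du]] := mdeg2P u2; have /mnm_lepP um' := um.
have := um' i; rewrite m1E Du mnmDE !mnm1E eqxx => ui.
have := um' j; rewrite m1E Du mnmDE !mnm1E eqxx => uj.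
have ij : i != j.
  apply: contraTneq ui => <-; rewrite eqxx -ltnNge.
  have [Hi|] := boolP (joins i a b).
    by rewrite !(joins_eqE _ _ Hi) ?eqxx ac ae a0 b0.
  have [Hi|_] := boolP (joins i 0 c).
    by rewrite !(joins_eqE _ _ Hi) ce c0 !andbF.
  by case: (joins i 0 e).
have Hi : [\/ joins i a b, joins i 0 c | joins i 0 e].
  by case: (joins i a b) (joins i 0 c) (joins i 0 e) ui => [] [] []; try by constructor.
have Hj : [\/ joins j a b, joins j 0 c | joins j 0 e].
  by case: (joins j a b) (joins j 0 c) (joins j 0 e) uj => [] [] [];
    rewrite ?addn1 ?addn0 //; try by constructor.
have Du' : u = (U_(j) + U_(i))%MM by rewrite addmC.
have cce : c \in [:: c; e] by rewrite !inE eqxx.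
have ece : e \in [:: c; e] by rewrite !inE eqxx orbT.
case: Hi => Hi; case: Hj => Hj.
- by case/eqP: ij; apply: joins_inj Hi Hj.
- exact: two_ab Hi Hj cce Du.
- exact: two_ab Hi Hj ece Du.
- exact: two_ab Hj Hi cce Du'.
- by case/eqP: ij; apply: joins_inj Hi Hj.
- exact: two_apex Hi Hj Du.
- exact: two_ab Hj Hi ece Du'.
- exact: two_apex Hj Hi Du'.
by case/eqP: ij; apply: joins_inj Hi Hj.
Qed.

(** A chord of the cycle 0, 1, ..., k - 1. *)
Definition chord (k s t : nat) := (s.+1 < t < k) && ~~ ((s == 0) && (t == k.-1)).

(** f lists a chordless cycle in the complement of the graph made of the edges up
    to a certain key: its chords are edges, and each of its sides is a non-edge or
    has a key above the keys of all chords. *)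
Definition chordless_cycle (k : nat) (f : nat -> nat) :=
  [/\ 4 <= k, forall s, s < k -> 0 < f s <= n,
      forall s t, s < t < k -> f s != f t &
      forall s t, chord k s t -> is_edge (f s) (f t) /\
        forall s' t', s' < t' < k -> ~~ chord k s' t' -> is_edge (f s') (f t') ->
          ~~ ord (key (f s') (f t')) (key (f s) (f t))].

Lemma chordless_cycle4 f : ~ chordless_cycle 4 f.
Proof.
case=> _ fn f_inj cyc.
have chords x y : x \in [:: f 0; f 2] -> y \in [:: f 1; f 3] -> is_edge x y ->
    ~~ ord (key x y) (key (f 0) (f 2)) && ~~ ord (key x y) (key (f 1) (f 3)).
  have side s t : s < t < 4 -> ~~ chord 4 s t -> is_edge (f s) (f t) ->
      ~~ ord (key (f s) (f t)) (key (f 0) (f 2)) &&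
      ~~ ord (key (f s) (f t)) (key (f 1) (f 3)).
    move=> st nst Est; have [_ /(_ s t st nst Est) ->] := cyc 0 2 isT.
    by have [_ /(_ s t st nst Est) ->] := cyc 1 3 isT.
  rewrite !inE => /orP[]/eqP-> /orP[]/eqP-> E; first exact: side.
  - exact: side.
  - by rewrite key_sym; apply: side; rewrite // is_edge_sym.
  exact: side.
have U : uniq [:: 0; f 0; f 2; f 1; f 3].
  rewrite /= !inE !negb_or; have := fn 0 isT; have := fn 1 isT.
  have := fn 2 isT; have := fn 3 isT.
  have := f_inj 0 1 isT; have := f_inj 0 2 isT; have := f_inj 0 3 isT.
  by have := f_inj 1 2 isT; have := f_inj 1 3 isT; have := f_inj 2 3 isT; lia.
have L : all (leq^~ n) [:: f 0; f 2; f 1; f 3].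
  rewrite /=; have := fn 0 isT; have := fn 1 isT.
  by have := fn 2 isT; have := fn 3 isT; lia.
have [E02 _] := cyc 0 2 isT; have [E13 _] := cyc 1 3 isT.
have /orP[le|le] := mo_total Hord
    (emon (f 1%N) (f 3%N) + emon 0 (f 0%N) + emon 0 (f 2%N))%MM
    (emon (f 0%N) (f 2%N) + emon 0 (f 1%N) + emon 0 (f 3%N))%MM.
  apply: square_half U L E02 _ le E13 => x y xin yin E.
  by case/andP: (chords x y xin yin E).
apply: (@square_half (f 1) (f 3) (f 0) (f 2)) le E02 => // [||x y xin yin E].
- by move: U; rewrite /= !inE !negb_or; lia.
- by move: L => /=; lia.
rewrite key_sym; rewrite is_edge_sym in E.
by case/andP: (chords y x yin xin E).
Qed.

(** The part of the cycle on one side of its largest chord ij. That chord becomes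
    a side, and it is strictly above all other chords since keys are distinct. *)
Lemma chordless_cycle_sub (k : nat) f (k' : nat) (phi : nat -> nat) (i j : nat) :
    chordless_cycle k f -> chord k i j ->
    (forall s t, chord k s t -> ord (key (f s) (f t)) (key (f i) (f j))) ->
    4 <= k' -> (forall s t, s < t < k' -> phi s < phi t < k) ->
    (forall s t, chord k' s t -> chord k (phi s) (phi t) /\ (phi s, phi t) != (i, j)) ->
    (forall s t, s < t < k' -> ~~ chord k' s t ->
       ~~ chord k (phi s) (phi t) \/ (phi s, phi t) = (i, j)) ->
  chordless_cycle k' (f \o phi).
Proof.
move=> [k4 fn f_inj cyc] ij maxij k'4 mono chords sides.
split=> // [s sk'|s t st|s t st].
- have [/(mono s) /andP[lt1 lt2]|last] := boolP (s < s.+1 < k').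
    by apply: fn; apply: ltn_trans lt2.
  have /mono/andP[_ lt] : 0 < s < k' by lia.
  exact: fn.
- by apply: f_inj; apply: mono.
have [kst neq_ij] := chords s t st; have [Est low] := cyc _ _ kst.
split=> // s' t' st' nst' E'; case: (sides s' t' st' nst') => [nch|[Ds Dt]].
  by apply: low => //; apply: mono.
rewrite /= Ds Dt; apply/negP => le; have le' := maxij _ _ kst.
have inj x y : x < k -> y < k -> f x = f y -> x = y.
  move=> xk yk fxy; have [lt|lt|//] := ltngtP x y.
    by have := f_inj x y; rewrite lt yk fxy eqxx => /(_ isT).
  by have := f_inj y x; rewrite lt xk fxy eqxx => /(_ isT).
have bounds x y : chord k x y -> [/\ x < y, x < k & y < k].
  rewrite /chord => /andP[/andP[xy yk] _].
  by split; [exact: ltnW | exact: ltn_trans (ltnW xy) yk | ].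
have [pst ps pt] := bounds _ _ kst; have [lt_ij ik jk] := bounds _ _ ij.
case: (@key_inj (f (phi s)) (f (phi t)) (f i) (f j)) => //.
- by case/andP: (fn _ ps).
- by case/andP: (fn _ pt).
- by apply: (mo_anti Hord); rewrite le le'.
- case=> /(inj _ _ ps ik) e1 /(inj _ _ pt jk) e2.
  by rewrite e1 e2 eqxx in neq_ij.
case=> /(inj _ _ ps jk) e1 /(inj _ _ pt ik) e2.
by move: pst; rewrite e1 e2 ltnNge ltnW.
Qed.

Lemma chordless_cycle_shrink (k : nat) f : 5 <= k -> chordless_cycle k f ->
  exists (k' : nat) g, k' < k /\ chordless_cycle k' g.
Proof.
move=> k5 cyc; have k0 : 0 < k by lia.
have k2 : 2 < k by lia.
pose ord' : rel 'X_{1..d} := fun x y => ord y x.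
(* the pair (0, 2) is a chord, hence there is a largest one *)
have := @extremumP _ ('I_k * 'I_k)%type ord' (Ordinal k0, Ordinal k2)
  (fun x => chord k x.1 x.2) (fun x => key (f x.1) (f x.2)).
case.
- exact: mo_refl Hord.
- by move=> y x z xy yz; apply: (mo_trans Hord) yz xy.
- by move=> x y; apply: (mo_total Hord).
- by rewrite /chord /=; lia.
case=> i j /= ij maxij.
have {}maxij s t : chord k s t -> ord (key (f s) (f t)) (key (f i) (f j)).
  move=> st; have sk : s < k by move: st; rewrite /chord; lia.
  have tk : t < k by move: st; rewrite /chord; lia.
  exact: (maxij (Ordinal sk, Ordinal tk)).
(* keep the side i, ..., j if it has at least 4 vertices; otherwise j = i + 2
   and the other side, which omits i + 1 only, has k - 1 >= 4 vertices *)
have [gap|gap] := ltnP 2 (j - i).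
  exists (j - i).+1, (f \o addn i); split; first by move: ij; rewrite /chord; lia.
  apply: (chordless_cycle_sub cyc ij maxij); first by lia.
  - by move=> s t; move: ij; rewrite /chord; lia.
  - by move=> s t; move: ij; rewrite /chord xpair_eqE; lia.
  move=> s t st; rewrite /chord => nst.
  have [/andP[/eqP s0 /eqP tj]|nst'] := boolP ((s == 0) && (t == j - i)).
    by right; rewrite s0 tj addn0 subnKC //; move: ij; rewrite /chord; lia.
  by left; move: ij; rewrite /chord; lia.
exists k.-1, (f \o (fun t => if t <= i then t else t.+1)); split; first by lia.
apply: (chordless_cycle_sub cyc ij maxij); first by lia.
- by move=> s t; move: ij; rewrite /chord; case: ifP; case: ifP; lia.
- by move=> s t; move: ij; rewrite /chord xpair_eqE; case: ifP; case: ifP; lia.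
move=> s t st; rewrite /chord => nst.
have [/andP[/eqP si /eqP ti]|nst'] := boolP ((s == i) && (t == i.+1)).
  right; rewrite si ti leqnn ltnn; congr (_, _).
  by move: ij; rewrite /chord; lia.
by left; move: ij; rewrite /chord; case: ifP; case: ifP; lia.
Qed.

Lemma no_chordless_cycle (k : nat) f : ~ chordless_cycle k f.
Proof.
have [m] := ubnP k; elim: m k f => // m IH k f km cyc.
have [k5|k4] := ltnP 4 k.
  have [k' [g [lt /IH]]] := chordless_cycle_shrink k5 cyc.
  by apply; apply: leq_trans lt _.
have Dk : k = 4 by case: cyc; lia.
by rewrite Dk in cyc; apply: chordless_cycle4 cyc.
Qed.

Lemma cone_chordless_cycle : chordless_cycle n succn.
Proof.
split=> [|s|s t|s t]; try lia.
rewrite /chord => st; split; first by apply/cone_edgeP; split; lia.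
move=> s' t' st' nst' /cone_edgeP[]; lia.
Qed.

End NoGroebner.

Theorem cone_no_quadratic_groebner (I : {mpoly K[d]} -> Prop) : fiber_ideal I ->
  ~ has_quadratic_groebner_basis I.
Proof.
move=> HI [ord [Hord [B [Bq Bg]]]].
exact: (no_chordless_cycle HI Hord Bq Bg (cone_chordless_cycle ord)).
Qed.
End ConedAnticycle.
End Reach.

End Configuration.

(** * Edge rings and vertex positions *)

Lemma mpolyX_sum (R : nzRingType) k (J : Type) (r : seq J) (p : pred J)
    (F : J -> 'X_{1..k}) :
  ('X_[\sum_(i <- r | p i) F i] = \prod_(i <- r | p i) 'X_[F i] :> {mpoly R[k]})%R.
Proof. by apply: (big_morph (fun m => 'X_[m])%R); [exact: mpolyXD | exact: mpolyX0]. Qed.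

Section Layout.
Variables (T : finType) (H : sgraph T) (pos : T -> nat).
Hypothesis pos_inj : injective pos.

Definition layout (P Q : 'I_#|edges H| -> nat) := forall i, exists x y,
  [/\ adj H x y, enum_val i = [set x; y], pos x = P i, pos y = Q i & P i < Q i].

Lemma edgesP (e : {set T}) :
  reflect (exists x y, adj H x y /\ e = [set x; y]) (e \in edges H).
Proof.
apply: (iffP imsetP) => [[[x y] /= xy ->]|[x [y [xy ->]]]].
  by exists x, y; rewrite inE in xy.
by exists (x, y); rewrite ?inE.
Qed.

Lemma exists_layout : exists P Q, layout P Q.
Proof.
suff /fin_all_exists[f fP] : forall i : 'I_#|edges H|, exists pq : nat * nat,
    exists x y, [/\ adj H x y, enum_val i = [set x; y], pos x = pq.1, pos y = pq.2 &
      pq.1 < pq.2].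
  by exists (fun i => (f i).1), (fun i => (f i).2).
move=> i; have /edgesP[x [y [xy ->]]] := enum_valP i.
have [lt|lt|/pos_inj Exy] := ltngtP (pos x) (pos y).
- by exists (pos x, pos y), x, y.
- by exists (pos y, pos x), y, x; rewrite adj_sym xy setUC.
by rewrite Exy adj_irrefl in xy.
Qed.

Variables P Q : 'I_#|edges H| -> nat.
Hypothesis PQ_layout : layout P Q.

Lemma layout_lt i : P i < Q i.
Proof. by have [x [y []]] := PQ_layout i. Qed.

Lemma layout_bound N : (forall x, pos x < N) -> forall i, Q i < N.
Proof. by move=> posN i; have [x [y [_ _ _ <- _]]] := PQ_layout i. Qed.

Lemma layout_inj i j : P i = P j -> Q i = Q j -> i = j.
Proof.
have [x [y [_ Ei <- <- _]]] := PQ_layout i.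
have [z [t [_ Ej <- <- _]]] := PQ_layout j.
by move=> /pos_inj xz /pos_inj yt; apply: enum_val_inj; rewrite Ei Ej xz yt.
Qed.

Lemma layout_edge x y : is_edge P Q (pos x) (pos y) = adj H x y.
Proof.
apply/is_edgeP/idP => [[i]|xy].
  rewrite /joins; have [z [t [zt _ <- <- _]]] := PQ_layout i.
  rewrite !(inj_eq pos_inj) => /orP[]/andP[/eqP<- /eqP<-] //.
  by rewrite adj_sym.
have xyE : [set x; y] \in edges H by apply/edgesP; exists x, y.
exists (enum_rank_in xyE [set x; y]).
rewrite /joins; have [z [t [_]]] := PQ_layout (enum_rank_in xyE [set x; y]).
rewrite enum_rankK_in // => E <- <- lt; rewrite !(inj_eq pos_inj).
have zxy : z \in [set x; y] by rewrite E !inE eqxx.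
have txy : t \in [set x; y] by rewrite E !inE eqxx orbT.
have zt : z != t by apply: contraTneq lt => ->; rewrite ltnn.
move: zxy txy zt; rewrite !inE => /orP[]/eqP-> /orP[]/eqP->; rewrite ?eqxx ?orbT //.
Qed.

Variable K : fieldType.
Local Open Scope ring_scope.

Definition image_exponent (m : 'X_{1..#|edges H|}) : 'X_{1..#|T|} :=
  (\sum_(i < #|edges H|)
     (\sum_(x in (enum_val i : {set T})) U_(enum_rank x)) *+ m i)%MM.

Lemma edge_ring_mapX m :
  edge_ring_map (G := H) 'X_[m] = 'X_[K, image_exponent m].
Proof.
rewrite /edge_ring_map comp_mpolyX /image_exponent mpolyX_sum.
apply: eq_bigr => i _; rewrite tnth_mktuple -mpolyXn; congr (_ ^+ _).
by rewrite /edge_monomial mpolyX_sum.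
Qed.

Lemma image_exponentE m z : image_exponent m (enum_rank z) = vdeg P Q m (pos z).
Proof.
rewrite mnm_sumE; apply: eq_bigr => i _; rewrite mulmnE mulnC; congr (_ * _)%N.
have [x [y [xy -> <- <- _]]] := PQ_layout i.
have xy' : x != y by apply: contraTneq xy => ->; rewrite adj_irrefl.
rewrite mnm_sumE big_setU1 ?inE //= big_set1 !mnm1E.
by rewrite !(inj_eq enum_rank_inj) !(inj_eq pos_inj).
Qed.

Lemma image_exponent_fiber u v :
  image_exponent u = image_exponent v <-> same_fiber P Q u v.
Proof.
split=> [E p|uv].
  have [/existsP[z /eqP <-]|none] := boolP [exists z, pos z == p].
    by rewrite -!image_exponentE E.
  have z m : vdeg P Q m p = 0%N.
    apply: big1 => i _; have [x [y [_ _ <- <- _]]] := PQ_layout i.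
    move/existsPn: none => none.
    by rewrite (negPf (none x)) (negPf (none y)) muln0.
  by rewrite !z.
by apply/mnmP=> j; rewrite -(enum_valK j) !image_exponentE.
Qed.

(** For the last property of [fiber_ideal]: the coefficient of the image of f at
    the image of m is the sum of the coefficients of f over the fiber of m, and it
    vanishes, so m is not alone in its fiber. *)
Lemma toric_fiber_ideal : fiber_ideal P Q (toric_ideal K H).
Proof.
rewrite /toric_ideal; split.
- by move=> f g; rewrite /edge_ring_map raddfD /= => -> ->; rewrite addr0.
- by move=> c f; rewrite /edge_ring_map rmorphM /= => ->; rewrite mulr0.
- move=> u v /image_exponent_fiber uv; rewrite /edge_ring_map raddfB /=.
  by have := edge_ring_mapX u; have := edge_ring_mapX v; rewrite /edge_ring_map => -> ->;
     rewrite uv subrr.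
move=> f m f0 mf.
have : (edge_ring_map f)@_(image_exponent m) = 0 by rewrite f0 mcoeff0.
rewrite /edge_ring_map comp_mpolyEX raddf_sum /= (bigD1_seq m) ?msupp_uniq //=.
have coef m' : (f@_m' *: (('X_[m'] : {mpoly K[_]}) \mPo
    [tuple edge_monomial K (enum_val i) | i < #|edges H|]))@_(image_exponent m) =
    f@_m' * (image_exponent m' == image_exponent m)%:R.
  by rewrite mcoeffZ; have := edge_ring_mapX m'; rewrite /edge_ring_map => ->; rewrite mcoeffX.
rewrite coef eqxx mulr1 => sum0.
have /hasP[m' m'f /andP[m'm /eqP E]] :
    has (fun m' => (m' != m) && (image_exponent m' == image_exponent m)) (msupp f).
  apply: contraTT mf => /hasPn none; rewrite -mcoeff_eq0 -sum0 big_seq_cond.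
  rewrite big1 ?addr0 // => m' /andP[m'f m'm]; rewrite coef.
  by have := none m' m'f; rewrite m'm /= => /negPf ->; rewrite mulr0.
by exists m'; split=> //; apply/image_exponent_fiber.
Qed.

End Layout.


Theorem groebner_of_crossings (K : fieldType) (T : finType) (H : sgraph T)
    (pos : T -> nat) (N : nat) : injective pos -> (forall x, pos x < N) ->
    (forall a b c e, pos a < pos b -> pos b < pos c -> pos c < pos e ->
       adj H a c && adj H b e) ->
  has_quadratic_groebner_basis (toric_ideal K H).
Proof.
move=> pos_inj posN cross; have [P [Q PQ]] := exists_layout H pos_inj.
have adjE := layout_edge pos_inj PQ.
apply: (crossings_groebner (layout_lt PQ) (layout_bound PQ posN)
         (layout_inj pos_inj PQ) (toric_fiber_ideal pos_inj PQ K)).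
move=> i j; have [x [y [_ _ <- <- xy]]] := PQ i.
have [z [t [_ _ <- <- zt]]] := PQ j.
by rewrite !adjE; split=> [yz|xz ty]; apply: cross.
Qed.

(** * Positions on the cycle, and the theorem *)

Section CyclePositions.
Variables (n : nat) (G : sgraph 'I_n).

Definition cycle_position (pos : 'I_n -> nat) :=
  [/\ injective pos, forall x, pos x < n, forall p, p < n -> exists x, pos x = p
    & forall x y, pos x < pos y -> adj G x y =
        ((pos x).+1 < pos y) && ~~ ((pos x == 0) && (pos y == n.-1))].

Lemma index_next (A : eqType) (c : seq A) x : uniq c -> x \in c ->
  index (next c x) c = if (index x c).+1 < size c then (index x c).+1 else 0.
Proof.
move=> Uc xc; rewrite next_nth xc; case: c Uc xc => [|y s Uc xc]; first by [].
move: (index x (y :: s)) => k; rewrite ltnS; case: ltnP => [lt|le].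
  exact: (@index_uniq _ y k.+1 (y :: s)).
by rewrite (nth_default y le) /= eqxx.
Qed.

Lemma cycle_position_exists : is_cycle_graph n (complement G) ->
  exists pos, cycle_position pos.
Proof.
case=> n3 [c [Uc c_all adjE]]; exists (index^~ c).
have posn x : index x c < n by rewrite -[ltnRHS](size_tuple c) index_mem.
have inj : injective (index^~ c).
  by move=> x y; apply: index_inj.
split=> // [p pn|x y lt].
  have c0 : 'I_n by exact: Ordinal pn.
  by exists (nth c0 c p); rewrite index_uniq ?size_tuple.
have xy : x != y by apply: contraTneq lt => ->; rewrite ltnn.
have := adjE x y; rewrite /= /compl_adj xy /= => /negbRL ->.
rewrite -(inj_eq inj) -[x == _](inj_eq inj) !index_next // !size_tuple.
move: lt (posn x) (posn y) => /=; move: (index x c) (index y c) => i j.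
by case: ifP; case: ifP; lia.
Qed.

End CyclePositions.

Section ConePositions.
Variables (n : nat) (G : sgraph 'I_n) (pos : 'I_n -> nat).
Hypothesis n_ge5 : 5 <= n.
Hypothesis pos_cycle : cycle_position G pos.
Variable K : fieldType.

(** A missing cycle vertex leaves its position to the apex, which is adjacent to
    all vertices; so non-adjacent vertices stay consecutive around the circle,
    whereas the first and the third of four positions never are. *)
Lemma proper_induced_groebner (W : {set option 'I_n}) : W != [set: option 'I_n] ->
  has_quadratic_groebner_basis (toric_ideal K (induced (suspension G) W)).
Proof.
have [pos_inj posn _ adjE] := pos_cycle.
rewrite -properT => /properP[_ [v _ vW]].
(* 0 is a default for the case that v is the apex *)
pose apex_pos := if v is Some w then pos w else 0.
pose pos' (x : {x | x \in W}) := if val x is Some i then pos i else apex_pos.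
have apex_free i : None \in W -> Some i \in W -> pos i != apex_pos.
  rewrite /apex_pos; case: (v) vW => [w|] vW NW iW; last by rewrite NW in vW.
  by rewrite (inj_eq pos_inj); apply: contraNneq vW => <-.
have pos'_inj : injective pos'.
  move=> [[x|] xW] [[y|] yW]; rewrite /pos' /= => E; apply: val_inj => //=.
  - by rewrite (pos_inj _ _ E).
  - by have := apex_free x yW xW; rewrite E eqxx.
  by have := apex_free y xW yW; rewrite E eqxx.
have pos'n x : pos' x < n.
  rewrite /pos' /apex_pos; case: (val x) => [i|]; first exact: posn.
  by case: (v) => [w|]; [apply: posn | lia].
have far x y : pos' x < pos' y -> (pos' x).+1 < pos' y ->
    ~~ ((pos' x == 0) && (pos' y == n.-1)) -> adj (induced (suspension G) W) x y.
  rewrite /= /ind_adj /pos' /=; case: x y => [[x|] xW] [[y|] yW] //=; last first.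
    by rewrite ltnn.
  by move=> lt far1 far2; rewrite adjE // far1.
apply: (groebner_of_crossings K pos'_inj pos'n) => a b c e ab bc ce.
by have := pos'n e => en; rewrite !far; lia.
Qed.

Definition cone_pos (x : option 'I_n) := if x is Some i then (pos i).+1 else 0.

Lemma cone_pos_inj : injective cone_pos.
Proof.
have [pos_inj _ _ _] := pos_cycle.
by move=> [x|] [y|] //= [/pos_inj ->].
Qed.

Lemma cone_pos_le x : cone_pos x < n.+1.
Proof. by have [_ posn _ _] := pos_cycle; case: x => [x|] //=; rewrite ltnS. Qed.

(** The cycle position p becomes p + 1, so that the wrap-around non-edge between
    0 and n - 1 becomes the pair 1, n. *)
Lemma cone_layout_edge (P Q : 'I_#|edges (suspension G)| -> nat) :
    layout cone_pos P Q ->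
  forall p q, p < q -> is_edge P Q p q =
    (q <= n) && ((p == 0) || (p.+1 < q) && ~~ ((p == 1) && (q == n))).
Proof.
have [pos_inj posn pos_onto adjE] := pos_cycle.
move=> PQ p q pq; have [qn|nq] := leqP q n; last first.
  case: (boolP (is_edge P Q p q)) => // /is_edgeP[i /orP[]/andP[/eqP Pi /eqP Qi]].
    by have := layout_bound PQ cone_pos_le i; lia.
  by have := layout_lt PQ i; lia.
have [y Dy] : exists y, (pos y).+1 = q.
  have [|y Dy] := pos_onto q.-1; first by lia.
  by exists y; rewrite Dy; lia.
have Qy : q = cone_pos (Some y) by [].
case: p pq => [|p] pq.
  by rewrite Qy -[0]/(cone_pos None) (layout_edge cone_pos_inj PQ).
have [x Dx] := pos_onto p (ltn_trans (leqnn _) (leq_trans pq qn)).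
rewrite Qy -{1}Dx -[(pos x).+1]/(cone_pos (Some x)) (layout_edge cone_pos_inj PQ) /=.
by rewrite adjE ?Dx; lia.
Qed.

Lemma cone_generated : gen_by_quadratic_binomials (toric_ideal K (suspension G)).
Proof.
have [P [Q PQ]] := exists_layout (suspension G) cone_pos_inj.
exact: (cone_gen_quadratic (layout_lt PQ) (layout_bound PQ cone_pos_le)
  (layout_inj cone_pos_inj PQ) n_ge5
  (cone_layout_edge PQ) (toric_fiber_ideal cone_pos_inj PQ K)).
Qed.

Lemma cone_no_groebner :
  ~ has_quadratic_groebner_basis (toric_ideal K (suspension G)).
Proof.
have [P [Q PQ]] := exists_layout (suspension G) cone_pos_inj.
exact: (cone_no_quadratic_groebner (layout_lt PQ)
  (layout_inj cone_pos_inj PQ) n_ge5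
  (cone_layout_edge PQ) (toric_fiber_ideal cone_pos_inj PQ K)).
Qed.

End ConePositions.

Lemma suspension_connected (T : finType) (G : sgraph T) :
  connected_graph (suspension G).
Proof.
have to_apex x : connect (adj (suspension G)) x None.
  by case: x => [x|]; [apply: connect1 | apply: connect0].
move=> x y; apply: connect_trans (to_apex x) _.
by case: y => [y|]; [apply: connect1 | apply: connect0].
Qed.

Theorem theorem2p8 (K : fieldType) (n : nat) (hn : (5 <= n)%N)
    (G : sgraph 'I_n) (hG : is_cycle_graph n (complement G)) :
  star_minimal K (suspension G) /\
  [/\ gen_by_quadratic_binomials (toric_ideal K (suspension G)),
      ~ has_quadratic_groebner_basis (toric_ideal K (suspension G))
    & forall W : {set option 'I_n}, W != [set: option 'I_n] ->
        has_quadratic_groebner_basis (toric_ideal K (induced (suspension G) W))].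
Proof.
have [pos pos_cycle] := cycle_position_exists hG.
have gen := cone_generated hn pos_cycle K.
have nogb := @cone_no_groebner _ _ _ hn pos_cycle K.
have sub := proper_induced_groebner hn pos_cycle K.
split; last by split.
split=> [||W /sub gbW [_]]; [exact: suspension_connected | by split | exact].
Qed.
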